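(* Let $(X,d,T)$ be a conformal system with derivative $a$ and let $u=\log a$. Let $Z\subset\mathcal{A}(0,\infty)\cap\mathcal{B}\cap\mathcal{C}$. Then $$\dim_H(Z)=\dim_{\mathrm{BS}}(Z,T,u),\qquad \dim_P(Z)=\mathrm{Dim}_{\mathrm{BS}}(Z,T,u).$$ In particular, if additionally $\underline{u}(x)\ge\alpha>0$ on $Z$, then $\dim_H(Z)$ and $\dim_P(Z)$ are the unique solutions of the lower and upper Bowen equations $\underline{P}(Z,T,-su)=0$ and $\overline{P}(Z,T,-su)=0$.
   Context: Conventions: $\log$ is base $2$; $\dim_H$, $\dim_P$ are Hausdorff and packing dimension; $\inf\emptyset=\infty$; $\alpha$ is a constant independent of $x$. Conformal system: $X$ is a complete separable metric space with metric $d$, $T\colon X\to X$ is uniformly continuous, the limit $a(x)=\lim_{y\to x}\frac{d(Tx,Ty)}{d(x,y)}$ exists in $(0,\infty)$ for every $x\in X$, and the function $\zeta(x,y)=\log d(Tx,Ty)-\log d(x,y)$ for $x\ne y$, $\zeta(x,x)=\log a(x)$, is uniformly continuous on $\{(x,y): d(x,y)<r_0\}$ for some $r_0>0$. Put $u=\log a$. For $f\colon X\to\mathbb{R}$, $S_nf=\sum_{k=0}^{n-1}f\circ T^k$; $\underline{u}(x)=\liminf_n\frac1nS_nu(x)$, $\overline{u}(x)=\limsup_n\frac1nS_nu(x)$. For $0\le\alpha_1\le\alpha_2\le\infty$, $\mathcal{A}(\alpha_1,\alpha_2)=\{x:\alpha_1<\underline{u}(x)\le\overline{u}(x)<\alpha_2\}$.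 $\mathcal{B}$ (tempered contraction) is the set of $x$ with $\inf_{n\in\mathbb{N},\,0\le k\le n}\bigl(S_{n-k}u(T^kx)+n\varepsilon\bigr)>-\infty$ for every $\varepsilon>0$. $\mathcal{C}$ (sublinear growth) is the set of $x$ with $\lim_{n\to\infty}u(T^nx)/n=0$. The Bowen ball is $B_n(x,T,\varepsilon)=\{y\in X: d(T^ix,T^iy)<\varepsilon \text{ for } 0\le i<n\}$; for uniformly continuous $f$, $f(x,n,\varepsilon)=\sup_{y\in B_n(x,T,\varepsilon)}S_nf(y)$. Let $\mathcal{P}(Z,N,\varepsilon)$ be the collection of countable families $\{(y_j,n_j)\}\subset X\times\{N,N+1,\dots\}$ with $Z\subset\bigcup_jB_{n_j}(y_j,T,\varepsilon)$. Lower (Pesin–Pitskel) pressure of uniformly continuous $\varphi$: $m_P(Z,s,\varphi,\varepsilon)=\lim_{N\to\infty}\inf_{\mathcal{P}(Z,N,\varepsilon)}\sum_j2^{-n_js+\varphi(y_j,n_j,\varepsilon)}$ for $s\in\mathbb{R}$; $\underline{P}(Z,T,\varphi)=\lim_{\varepsilon\to0}\inf\{s\in\mathbb{R}:m_P(Z,s,\varphi,\varepsilon)=0\}$. Upper (packing) pressure, in modified upper capacity form: $N(Z,T,\varphi,n,\varepsilon)=\inf\{\sum_{x\in E}2^{\varphi(x,n,\varepsilon)}:E\subset X\text{ countable},Z\subset\bigcup_{x\in E}B_n(x,T,\varepsilon)\}$; $P_{\mathrm{UC}}(Z,T,\varphi,\varepsilon)=\limsup_n\frac1n\log N(Z,T,\varphi,n,\varepsilon)$;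 $\overline{P}(Z,T,\varphi)=\lim_{\varepsilon\to0}\inf\{\sup_iP_{\mathrm{UC}}(Z_i,T,\varphi,\varepsilon):Z\subset\bigcup_{i\in\mathbb{N}}Z_i\}$. Lower BS dimension: $m_{BS}(Z,s,u,\varepsilon)=\lim_{N\to\infty}\inf_{\mathcal{P}(Z,N,\varepsilon)}\sum_j2^{-s\,u(y_j,n_j,\varepsilon)}$ for $s\ge0$; $\dim_{\mathrm{BS}}(Z,T,u)=\lim_{\varepsilon\to0}\inf\{s\ge0:m_{BS}(Z,s,u,\varepsilon)=0\}$. Upper BS dimension: $M(Z,T,u,s,n,\varepsilon)=\inf\{\sum_{x\in\Gamma}2^{-s\,u(x,n,\varepsilon)}:\Gamma\subset X\text{ countable},Z\subset\bigcup_{x\in\Gamma}B_n(x,T,\varepsilon)\}$; $\dim_{\mathrm{BSC}}(Z,T,u,\varepsilon)=\inf\{s\ge0:\limsup_nM(Z,T,u,s,n,\varepsilon)<\infty\}$; $\mathrm{Dim}_{\mathrm{BS}}(Z,T,u)=\lim_{\varepsilon\to0}\inf\{\sup_i\dim_{\mathrm{BSC}}(Z_i,T,u,\varepsilon):Z\subset\bigcup_{i\in\mathbb{N}}Z_i\}$.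
   Formalization: That the dimension solves its Bowen equation is stated only for nonempty Z, finite dimension, and upper averages of u bounded by a constant on Z, since it can fail otherwise; that every real solution equals the dimension is stated without these conditions. *)

(* Defs.v *)
(* MathComp-Analysis *)
From HB Require Import structures.
From mathcomp Require Import all_boot all_order all_algebra.
From mathcomp Require Import all_classical all_reals all_analysis.

Set Implicit Arguments.
Unset Strict Implicit.
Unset Printing Implicit Defensive.

Import Order.TTheory GRing.Theory Num.Theory.
Import numFieldNormedType.Exports.

Local Open Scope classical_set_scope.
Local Open Scope ring_scope.

Definition log2 (R : realType) (x : R) : R := ln x / ln 2.

(* [0 |-> -oo] and [+oo |-> +oo] *)
Definition log2e (R : realType) (x : \bar R) : \bar R :=
  (lne x * ((ln 2)^-1)%:E)%E.

Definition exp2e (R : realType) (x : \bar R) : \bar R :=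
  expeR (x * (ln 2)%:E)%E.

Definition complete_space (X : uniformType) : Prop :=
  forall F : set_system X, ProperFilter F -> cauchy F -> exists x : X, F --> x.

Definition separable_space (X : topologicalType) : Prop :=
  exists2 D : set X, countable D & dense D.

Section Dimensions.
Context {R : realType} {X : metricType R}.
Implicit Types (Z U : set X) (s delta : R).
Local Open Scope ereal_scope.

(* [0] is adjoined so that the empty set has diameter [0] rather than [-oo]. *)
Definition diam U : \bar R :=
  ereal_sup (0 |` [set (mdist p.1 p.2)%:E | p in U `*` U]).

(* Covers are countable sets of sets: finite and empty covers are included. *)
Definition hausdorff_premeasure s delta Z : \bar R :=
  ereal_inf [set \esum_(U in C) (diam U `^ s) | C in
    [set C : set (set X) | [/\ countable C,
       forall U, C U -> diam U <= delta%:E & Z `<=` \bigcup_(U in C) U]]].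

Definition hausdorff_measure s Z : \bar R :=
  lim (hausdorff_premeasure s delta Z @[delta --> (0%R : R)^'+]).

Definition dim_H Z : \bar R :=
  ereal_inf [set s%:E | s in [set s : R | (0 <= s)%R /\
    hausdorff_measure s Z = 0]].

Definition cball (x : X) (r : R) : set X := [set y | (mdist x y <= r)%R].

(* A packing is a countable set of pairs (center, radius); in a general metric
   space it is the radius, not the diameter of the ball, that enters the sum. *)
Definition packing_premeasure s delta Z : \bar R :=
  ereal_sup [set \esum_(p in F) ((2 * p.2) `^ s)%:E | F in
    [set F : set (X * R) | [/\ countable F,
       forall p, F p -> Z p.1 /\ (0 < p.2 <= delta)%R &
       trivIset F (fun p => cball p.1 p.2)]]].

Definition packing_limit s Z : \bar R :=
  lim (packing_premeasure s delta Z @[delta --> (0%R : R)^'+]).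

(* [packing_limit] is not countably subadditive. *)
Definition packing_measure s Z : \bar R :=
  ereal_inf [set \sum_(0 <= i <oo) packing_limit s (A i) | A in
    [set A : nat -> set X | Z `<=` \bigcup_i A i]].

Definition dim_P Z : \bar R :=
  ereal_inf [set s%:E | s in [set s : R | (0 <= s)%R /\
    packing_measure s Z = 0]].

End Dimensions.

Section Dynamics.
Context {R : realType} {X : metricType R}.
Variable T : X -> X.
Implicit Types (Z : set X) (f u phi : X -> R) (s e : R) (n N : nat).

Section Conformal.
Variable a : X -> R.

Definition zeta (x y : X) : R :=
  if x == y then log2 (a x)
  else log2 (mdist (T x) (T y)) - log2 (mdist x y).

(* Since [ln 0 = 0], the clause [0 < mdist (T x) (T y)] records that [zeta] is
   real-valued near the diagonal. The limit is along the punctured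
   neighborhoods of [x]; it is void at an isolated point. *)
Definition conformal : Prop :=
  [/\ unif_continuous T,
      (forall x, 0 < a x /\
        mdist (T x) (T y) / mdist x y @[y --> x^'] --> a x) &
      exists2 r0 : R, 0 < r0 &
        (forall x y, x != y -> mdist x y < r0 -> 0 < mdist (T x) (T y)) /\
        (forall e, 0 < e -> exists2 delta : R, 0 < delta &
          forall x y x' y', mdist x y < r0 -> mdist x' y' < r0 ->
            mdist x x' < delta -> mdist y y' < delta ->
            `|zeta x y - zeta x' y'| < e)].

End Conformal.

Definition birkhoff f n (x : X) : R := \sum_(k < n) f (iter k T x).

Definition lower_avg u (x : X) : \bar R :=
  limn_einf (fun n => (birkhoff u n x / n%:R)%:E).

Definition upper_avg u (x : X) : \bar R :=
  limn_esup (fun n => (birkhoff u n x / n%:R)%:E).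

Definition avg_between u (alpha1 alpha2 : \bar R) : set X :=
  [set x | [/\ alpha1 < lower_avg u x, lower_avg u x <= upper_avg u x &
               upper_avg u x < alpha2]%E].

Definition tempered_contraction u : set X :=
  [set x | forall e, 0 < e ->
    (-oo < ereal_inf
      [set (birkhoff u (nk.1 - nk.2)%N (iter nk.2 T x) + nk.1%:R * e)%:E
      | nk in [set nk : nat * nat | (nk.2 <= nk.1)%N]])%E].

Definition sublinear_growth u : set X :=
  [set x | u (iter n T x) / n%:R @[n --> \oo] --> (0 : R)].

Definition bowen_ball n (x : X) e : set X :=
  [set y | forall i, (i < n)%N -> mdist (iter i T x) (iter i T y) < e].

Local Open Scope ereal_scope.

Definition bowen_sup f (x : X) n e : \bar R :=
  ereal_sup [set (birkhoff f n y)%:E | y in bowen_ball n x e].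

(* Pairs (center, order) *)
Definition bowen_covers Z N e : set (set (X * nat)) :=
  [set F | [/\ countable F, forall p, F p -> (N <= p.2)%N &
     Z `<=` \bigcup_(p in F) bowen_ball p.2 p.1 e]].

Definition spanning_sets Z n e : set (set X) :=
  [set E | countable E /\ Z `<=` \bigcup_(x in E) bowen_ball n x e].

Definition m_P Z s phi e : \bar R :=
  limn (fun N => ereal_inf
    [set \esum_(p in F) exp2e (- (p.2%:R * s)%:E + bowen_sup phi p.1 p.2 e)
    | F in bowen_covers Z N e]).

Definition lower_pressure Z phi : \bar R :=
  lim (ereal_inf [set s%:E | s in [set s : R | m_P Z s phi e = 0]]
    @[e --> (0%R : R)^'+]).

Definition span_sum Z phi n e : \bar R :=
  ereal_inf [set \esum_(x in E) exp2e (bowen_sup phi x n e)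
    | E in spanning_sets Z n e].

Definition P_UC Z phi e : \bar R :=
  limn_esup (fun n => (n%:R^-1)%:E * log2e (span_sum Z phi n e)).

Definition upper_pressure Z phi : \bar R :=
  lim (ereal_inf [set ereal_sup [set P_UC (A i) phi e | i in [set: nat]]
      | A in [set A : nat -> set X | Z `<=` \bigcup_i A i]]
    @[e --> (0%R : R)^'+]).

Definition m_BS Z s u e : \bar R :=
  limn (fun N => ereal_inf
    [set \esum_(p in F) exp2e (- (s%:E * bowen_sup u p.1 p.2 e))
    | F in bowen_covers Z N e]).

Definition dim_BS Z u : \bar R :=
  lim (ereal_inf [set s%:E | s in [set s : R | (0 <= s)%R /\
      m_BS Z s u e = 0]] @[e --> (0%R : R)^'+]).

Definition M_BS Z u s n e : \bar R :=
  ereal_inf [set \esum_(x in E) exp2e (- (s%:E * bowen_sup u x n e))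
    | E in spanning_sets Z n e].

Definition dim_BSC Z u e : \bar R :=
  ereal_inf [set s%:E | s in [set s : R | (0 <= s)%R /\
    limn_esup (fun n => M_BS Z u s n e) < +oo]].

Definition Dim_BS Z u : \bar R :=
  lim (ereal_inf [set ereal_sup [set dim_BSC (A i) u e | i in [set: nat]]
      | A in [set A : nat -> set X | Z `<=` \bigcup_i A i]]
    @[e --> (0%R : R)^'+]).

End Dynamics.

(* Main.v *)
Require Import Defs.
From HB Require Import structures.
From mathcomp Require Import all_boot all_order all_algebra.
From mathcomp Require Import all_classical all_reals all_analysis.
From mathcomp Require Import lra.
Import Order.TTheory GRing.Theory Num.Theory.
Import numFieldNormedType.Exports.
Local Open Scope classical_set_scope.
Local Open Scope ring_scope.

(** Put [S n x] for the [n]-th Birkhoff sum of [u = log a] at [x]. By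
    conformality and uniform continuity of [zeta], one application of [T]
    multiplies small distances near [x] by [exp2 (u x)] up to a factor [exp2
    (+- e)], with [e] as small as wanted at small scales. Along an orbit these
    errors multiply to [exp2 (+- n e)]. So a Bowen ball of order [n] at [x]
    should look like a metric ball of radius [exp2 (- S n x)], up to
    subexponential factors. One inclusion ([bowen_ball_mdist_le]) uses
    sublinear growth, because the Bowen ball does not see the last derivative;
    the other ([ball_sub_bowen_ball]) uses tempered contraction, which prevents
    a metric ball from growing too much at an intermediate time. Positive
    exponents make [exp2 (- S n x)] run through all small radii, again up to
    subexponential factors ([inner_scale], [outer_scale]).

    Hence covers by sets of small diameter and covers by Bowen balls can be
    turned into each other, if the weight [w (y, n)] of a Bowen ball is
    compared with [exp2 (- s * S n x)], provided that the comparison leaves an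
    exponential factor [exp2 (n * theta)] that absorbs the subexponential
    errors ([hausdorff_bowen_null], [bowen_hausdorff_null]). The same holds
    between packings and spanning sets. From packings to spanning sets, a
    maximal packing by balls with a third of the radii of those inscribed in
    the Bowen balls of order [n] gives a spanning set; conversely, the balls of
    a packing are sorted by the order of the Bowen balls inscribed in them, and
    those of one order are separated by the Bowen balls of a spanning set
    ([packing_span_bounded], [span_bounded_packing]). All constants are uniform
    only on pieces of [Z], but countably many pieces suffice and all the
    notions involved are countably stable.

    What remains is the choice of weights, and it is the same in both cases
    ([dimension_comparison]). For the BS dimensions, the factor [exp2 (n *
    theta)] comes from an arbitrarily small change of the exponent [s], as [S n
    x] grows at least linearly ([dim_eq_scale_limit]). For the pressure of [- s
    * u] at the level [t] the weight is about [exp2 (- n * t - s * S n x)];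
    since [S n x] is at least about [n * alpha], the pressure decreases
    strictly in [s], which gives uniqueness ([bowen_equation_unique]), and
    since [S n x] is at most about [n * beta], the pressure cannot jump over
    zero, which gives existence ([bowen_equation_solvable]). *)

Set Implicit Arguments.
Unset Strict Implicit.
Unset Printing Implicit Defensive.

(** * Powers of two and limits at zero *)

Definition exp2 {R : realType} (r : R) : R := expR (r * ln 2).

Section Exp2.
Context {R : realType}.
Implicit Types r s t : R.

Lemma ln2_gt0 : 0 < ln 2 :> R.
Proof. by apply: ln_gt0; rewrite ltr1n. Qed.

Lemma exp2_gt0 r : 0 < exp2 r.
Proof. exact: expR_gt0. Qed.

Lemma exp2_ge0 r : 0 <= exp2 r.
Proof. exact: expR_ge0. Qed.

Lemma exp2_0 : exp2 0 = 1 :> R.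
Proof. by rewrite /exp2 mul0r expR0. Qed.

Lemma exp2D r s : exp2 (r + s) = exp2 r * exp2 s.
Proof. by rewrite /exp2 mulrDl expRD. Qed.

Lemma exp2N r : exp2 (- r) = (exp2 r)^-1.
Proof. by rewrite /exp2 mulNr expRN. Qed.

Lemma exp2_1 : exp2 1 = 2 :> R.
Proof. by rewrite /exp2 mul1r lnK// posrE. Qed.

Lemma ler_exp2 r s : (exp2 r <= exp2 s) = (r <= s).
Proof. by rewrite /exp2 ler_expR ler_pM2r// ln2_gt0. Qed.

Lemma ltr_exp2 r s : (exp2 r < exp2 s) = (r < s).
Proof. by rewrite /exp2 ltr_expR ltr_pM2r// ln2_gt0. Qed.

Lemma log2K r : 0 < r -> exp2 (log2 r) = r.
Proof.
by move=> r0; rewrite /exp2 /log2 divfK ?gt_eqF ?ln2_gt0// lnK.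
Qed.

Lemma powR_exp2 r s : exp2 r `^ s = exp2 (s * r).
Proof. by rewrite /powR gt_eqF ?exp2_gt0// /exp2 expRK mulrA. Qed.

Lemma exp2Xn r n : exp2 r ^+ n = exp2 (n%:R * r).
Proof. by rewrite /exp2 -expRM_natl mulrA. Qed.

Lemma log2_div r s : 0 < r -> 0 < s -> log2 (r / s) = log2 r - log2 s.
Proof.
by move=> r0 s0; rewrite /log2 ln_div ?posrE// mulrBl.
Qed.

Lemma le_mul_exp2 r s t : 0 < r -> 0 < s ->
  (r <= s * exp2 t) = (log2 r - log2 s <= t).
Proof.
move=> r0 s0; rewrite -[in LHS](log2K r0) -[in LHS](log2K s0) -exp2D ler_exp2.
by rewrite lerBlDl.
Qed.

Lemma mul_exp2_le r s t : 0 < r -> 0 < s ->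
  (s * exp2 t <= r) = (t <= log2 r - log2 s).
Proof.
move=> r0 s0; rewrite -[in LHS](log2K r0) -[in LHS](log2K s0) -exp2D ler_exp2.
by rewrite lerBrDl.
Qed.

Local Open Scope ereal_scope.
Implicit Types x y : \bar R.

Lemma exp2e_EFin r : exp2e r%:E = (exp2 r)%:E.
Proof. by []. Qed.

Lemma exp2e_ge0 x : 0 <= exp2e x.
Proof. exact: expeR_ge0. Qed.

Lemma lee_exp2e x y : x <= y -> exp2e x <= exp2e y.
Proof.
by move=> xy; rewrite /exp2e lee_expeR lee_pmul2r// lte_fin ln2_gt0.
Qed.

Lemma exp2eD r y : exp2e (r%:E + y) = (exp2 r)%:E * exp2e y.
Proof.
case: y => [y| |]; rewrite /exp2e.
- by rewrite -EFinD -!EFinM mulrDl /= expRD.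
- rewrite addey// mulyr gtr0_sg ?ln2_gt0// mul1e /=.
  by rewrite mulry gtr0_sg ?mul1e// exp2_gt0.
- by rewrite addeNy mulNyr gtr0_sg ?ln2_gt0// mul1e /= mule0.
Qed.

Lemma log2e_le x r : x <= (exp2 r)%:E -> log2e x <= r%:E.
Proof.
move=> xr; rewrite /log2e -(@lee_pmul2r _ (ln 2)%:E) ?lte_fin ?ln2_gt0//.
rewrite -muleA -EFinM mulVf ?gt_eqF ?ln2_gt0// mule1 -EFinM.
case: x xr => [x| |]//=; rewrite ?leNye//.
case: ifPn => [_ _|]; first by rewrite leNye.
by rewrite -ltNge lee_fin => x0 xr; rewrite lee_fin -ler_expR lnK.
Qed.

Lemma log2e_lt x r : log2e x < r%:E -> x < (exp2 r)%:E.
Proof.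
rewrite /log2e -(@lte_pmul2r _ (ln 2)%:E) ?lte_fin ?ln2_gt0//.
rewrite -muleA -EFinM mulVf ?gt_eqF ?ln2_gt0// mule1 -EFinM.
case: x => [x| |]//=; rewrite ?ltNyr//.
case: ifPn => [x0 _|]; first by rewrite lte_fin (le_lt_trans x0)// exp2_gt0.
by rewrite -ltNge !lte_fin => x0 xr; rewrite -ltr_expR lnK in xr.
Qed.

End Exp2.

Section Limits.
Context {R : realType}.
Local Open Scope ereal_scope.

Lemma near_at0P (P : R -> Prop) : (\forall x \near (0%R : R)^'+, P x) <->
  exists2 d : R, (0 < d)%R & forall x, (0 < x < d)%R -> P x.
Proof.
split=> [/nbhs_ballP[d /= d0 dP]|[d d0 dP]].
  exists d => // x /andP[x0 xd]; apply: dP => //.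
  by rewrite /ball/= sub0r normrN gtr0_norm.
apply/nbhs_ballP; exists d => //= x; rewrite /ball/= sub0r normrN => xd x0.
by apply: dP; rewrite x0 -(gtr0_norm x0).
Qed.

Lemma lim_at0_inf (f : R -> \bar R) :
  (forall x y : R, (0 < x)%R -> (x <= y)%R -> f x <= f y) ->
  lim (f x @[x --> (0%R : R)^'+]) = ereal_inf (f @` [set x | (0 < x)%R]).
Proof.
move=> ndf; have -> : [set x : R | (0 < x)%R] = [set` `]0%R, +oo[].
  by apply/seteqP; split=> x /=; rewrite in_itv/= andbT.
apply: cvg_lim => //; apply: nondecreasing_at_right_cvge => // x y.
by rewrite in_itv/= andbT => x0 _; exact: ndf.
Qed.

Lemma lim_at0_sup (f : R -> \bar R) :
  (forall x y : R, (0 < x)%R -> (x <= y)%R -> f y <= f x) ->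
  lim (f x @[x --> (0%R : R)^'+]) = ereal_sup (f @` [set x | (0 < x)%R]).
Proof.
move=> nif; have -> : [set x : R | (0 < x)%R] = [set` `]0%R, +oo[].
  by apply/seteqP; split=> x /=; rewrite in_itv/= andbT.
apply: cvg_lim => //; apply: nonincreasing_at_right_cvge => // x y.
by rewrite in_itv/= andbT => x0 _; exact: nif.
Qed.

(** The pressures at scale [e] are not monotone in [e], because the supremum of
    the potential over a larger Bowen ball is larger; but the loss is at most
    the oscillation of the potential, and that is enough for convergence. *)
Lemma lim_at0_quasimonotone (f : R -> \bar R) :
  (forall eta : R, (0 < eta)%R -> exists2 d : R, (0 < d)%R &
     forall x y : R, (0 < x)%R -> (x <= y)%R -> (y < d)%R ->
       f y <= f x + eta%:E) ->
  cvg (f x @[x --> (0%R : R)^'+]).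
Proof.
move=> qf.
pose I d := ereal_inf (f @` [set x | (0 < x < d)%R]).
pose S d := ereal_sup (f @` [set x | (0 < x < d)%R]).
have cI : I x @[x --> (0%R : R)^'+] --> ereal_sup (I @` [set` `]0%R, +oo[]).
  apply: nonincreasing_at_right_cvge => // x y _ _ xy.
  apply: ereal_inf_le_tmp => _ [z /= /andP[z0 zx] <-]; exists z => //=.
  by rewrite z0 (lt_le_trans zx).
have cS : S x @[x --> (0%R : R)^'+] --> ereal_inf (S @` [set` `]0%R, +oo[]).
  apply: nondecreasing_at_right_cvge => // x y _ _ xy.
  apply: ereal_sup_le => _ [z /= /andP[z0 zx] <-]; exists z => //=.
  by rewrite z0 (lt_le_trans zx).
set L := ereal_sup _ in cI; set U := ereal_inf _ in cS.
have UL : U <= L.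
  apply/lee_addgt0Pr => eta eta0; have [d d0 qd] := qf _ eta0.
  apply: (@le_trans _ _ (S d)).
    by apply: ereal_inf_lbound; exists d => //=; rewrite in_itv/= d0.
  apply: ge_ereal_sup => _ [y /= /andP[y0 yd] <-].
  apply: (@le_trans _ _ (I y + eta%:E)).
    rewrite -leeBlDr//; apply: le_ereal_inf_tmp => _ [x /= /andP[x0 xy] <-].
    by rewrite EFinN leeBlDr//; apply: qd => //; exact: ltW.
  rewrite leeD2r//; apply: ereal_sup_ubound; exists y => //=.
  by rewrite in_itv/= y0.
have LU : (L <= U)%E.
  apply: ge_ereal_sup => _ [x x0 <-]; rewrite /= in_itv/= andbT in x0.
  apply: le_ereal_inf_tmp => _ [y y0 <-]; rewrite /= in_itv/= andbT in y0.
  pose z := (Num.min x y / 2)%R.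
  have m0 : (0 < Num.min x y)%R by rewrite lt_min x0.
  have z0 : (0 < z)%R by rewrite divr_gt0.
  have zm : (z < Num.min x y)%R by rewrite ltr_pdivrMr// mulr_natr mulr2n ltrDl.
  move: (zm); rewrite lt_min => /andP[zx zy].
  apply: (@le_trans _ _ (f z)).
    by apply: ereal_inf_lbound; exists z => //=; rewrite z0.
  by apply: ereal_sup_ubound; exists z => //=; rewrite z0.
have {UL LU}E : U = L by apply/eqP; rewrite eq_le UL.
rewrite E in cS.
apply/cvg_ex; exists L.
(* [f x] lies between the bounds over ]0, 2 x[, which contains [x]. *)
have dbl (g : R -> \bar R) l : g x @[x --> (0%R : R)^'+] --> l ->
    g (2 * x)%R @[x --> (0%R : R)^'+] --> l.
  move=> cg; apply: cvg_comp cg => A /near_at0P[d d0 dA].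
  apply/near_at0P; exists (d / 2)%R; first by rewrite divr_gt0.
  by move=> x /andP[x0 xd]; apply: dA; lra.
apply: squeeze_cvge; [|exact: dbl cI|exact: dbl cS].
near=> x; have x0 : (0 < x)%R by [].
have xx : (0 < x < 2 * x)%R by rewrite x0 mulr_natl mulr2n ltrDl.
by rewrite ereal_inf_lbound ?ereal_sup_ubound//; exists x.
Unshelve. all: by end_near. Qed.

Lemma limn_sup (f : nat -> \bar R) :
  (forall m n, (m <= n)%N -> f m <= f n) ->
  limn f = ereal_sup (range f).
Proof.
by move=> ndf; apply: cvg_lim => //; exact: ereal_nondecreasing_cvgn.
Qed.

Lemma limn_esup_lt (f : nat -> \bar R) l : limn_esup f < l ->
  exists N, forall n, (N <= n)%N -> f n < l.
Proof.
move=> /ereal_inf_lt[_ [V [N _ NV] <-] Vl]; exists N => n Nn.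
by apply: le_lt_trans Vl; apply: ereal_sup_ubound; exists n => //; exact: NV.
Qed.

Lemma limn_esup_lt_fin (f : nat -> \bar R) : limn_esup f < +oo ->
  exists (M : R) (N : nat), forall n, (N <= n)%N -> f n < M%:E.
Proof.
move=> foo; have [M] : exists M : R, limn_esup f < M%:E.
  case: (limn_esup f) foo => [r| |]// _.
    by exists (r + 1)%R; rewrite lte_fin ltrDl.
  by exists 0%R; rewrite ltNyr.
by move=> /limn_esup_lt[N NP]; exists M, N.
Qed.

Lemma limn_esup_le (f : nat -> \bar R) l N :
  (forall n, (N <= n)%N -> f n <= l) -> limn_esup f <= l.
Proof.
move=> fl; apply: ge_ereal_inf; exists (ereal_sup (f @` [set n | (N <= n)%N])).
  by exists [set n | (N <= n)%N] => //; exists N.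
by apply: ge_ereal_sup => _ [n /= Nn <-]; exact: fl.
Qed.

Lemma limn_einf_gt (f : nat -> \bar R) l : l < limn_einf f ->
  exists N, forall n, (N <= n)%N -> l < f n.
Proof.
rewrite /limn_einf lteNr => /limn_esup_lt[N fN]; exists N => n /fN /=.
by rewrite lteN2.
Qed.

Lemma eventually_bounded (f : nat -> R) (N : nat) :
  (forall n, (N <= n)%N -> (f n <= 0)%R) ->
  exists2 K : R, (0 <= K)%R & forall n, (f n <= K)%R.
Proof.
move=> fN; have sum0 (P : pred 'I_N) : (0 <= \sum_(i | P i) `|f i|)%R.
  by rewrite sumr_ge0.
exists (\sum_(i < N) `|f i|)%R => // n; have [/fN/le_trans|nN] := leqP N n.
  exact.
rewrite (bigD1 (Ordinal nN))//= (le_trans (ler_norm _))// lerDl.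
exact: sum0.
Qed.

End Limits.

(** * Sums over sets and covers of arbitrarily small cost *)

Section Esum.
Context {R : realType}.
Local Open Scope ereal_scope.

Lemma esum_subset (I : choiceType) (A B : set I) (w : I -> \bar R) :
  A `<=` B -> \esum_(i in A) w i <= \esum_(i in B) w i.
Proof.
move=> AB; apply: ereal_sup_le => _ [F [finF FA] <-]; exists F => //.
by split=> // x /FA /AB.
Qed.

Lemma esum_image_le (I J : choiceType) (A : set I) (g : I -> J)
    (w : J -> \bar R) :
  \esum_(j in g @` A) w j <= \esum_(i in A) w (g i).
Proof.
have [->|/set0P[i0 Ai0]] := eqVneq A set0; first by rewrite image_set0 !esum_set0.
have /choice[h hP] : forall j, exists i, (g @` A) j -> A i /\ g i = j.
  move=> j; have [[i Ai <-]|nj] := pselect ((g @` A) j); first by exists i.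
  by exists i0 => /nj.
have hg : \esum_(j in g @` A) w j = \esum_(j in g @` A) w (g (h j)).
  by apply: eq_esum => j /hP[_ ->].
rewrite hg -(esum_image _ h (fun i => w (g i))).
  by apply: esum_subset => _ [j /hP[Ahj _] <-].
move=> j k; rewrite !inE => /hP[_ hj] /hP[_ hk] hjk.
by rewrite -hj -hk hjk.
Qed.

Lemma esum_bigcup_le (I : choiceType) (F : nat -> set I) (w : I -> \bar R) :
  (forall i, 0 <= w i) ->
  \esum_(i in \bigcup_k F k) w i <= \sum_(k <oo) \esum_(i in F k) w i.
Proof.
move=> w0; rewrite seqDU_bigcup_eq (nneseries_sum_bigcup (@trivIset_seqDU _ F))//.
apply: lee_nneseries => [k _ _|k _]; first by rewrite esum_ge0.
by apply: esum_subset; exact: subset_seqDU.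
Qed.

Lemma esumZ_le (I : choiceType) (A : set I) (w : I -> \bar R) (c : R) :
  (0 <= c)%R -> (forall i, 0 <= w i) ->
  \esum_(i in A) (c%:E * w i) <= c%:E * \esum_(i in A) w i.
Proof.
move=> c0 w0; apply: ge_ereal_sup => _ [F [finF FA] <-].
rewrite -ge0_mule_fsumr// lee_pmul// ?lee_fin ?fsume_ge0//.
by apply: ereal_sup_ubound; exists F.
Qed.

Lemma geometric_nneseries_lt (theta : R) : (0 < theta)%R ->
  exists2 C : R, (0 <= C)%R & \sum_(n <oo) (exp2 (- (n%:R * theta)))%:E <= C%:E.
Proof.
move=> th0; pose q := exp2 (- theta).
have q0 : (0 <= q)%R by exact: exp2_ge0.
have q1 : (q < 1)%R by rewrite -exp2_0 ltr_exp2 oppr_lt0.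
exists (1 - q)^-1%R; first by rewrite invr_ge0 subr_ge0 ltW.
apply: lime_le; first by apply: is_cvg_nneseries => n _ _; rewrite lee_fin exp2_ge0.
apply: nearW => n; rewrite sumEFin lee_fin.
have -> : (\sum_(0 <= i < n) exp2 (- (i%:R * theta)) =
           \sum_(0 <= i < n) q ^+ i)%R.
  by apply: eq_bigr => i _; rewrite exp2Xn mulrN.
have := geometric_seriesE 1%R (negbT (lt_eqF q1)).
move=> /(congr1 (fun f => f n)); rewrite /series/= => h.
have -> : (\sum_(0 <= i < n) q ^+ i = (1 - q ^+ n) / (1 - q))%R.
  by rewrite -[RHS]mul1r mulrA -h; apply: eq_bigr => i _; rewrite mul1r.
by rewrite ler_piMl ?invr_ge0 ?subr_ge0 ?(ltW q1)// gerBl exprn_ge0.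
Qed.

Lemma ereal_inf_eq0P (A : set (\bar R)) : (forall y, A y -> 0 <= y) ->
  ereal_inf A = 0 <->
  forall b : R, (0 < b)%R -> exists2 y, A y & y <= b%:E.
Proof.
move=> A0; split=> [A_0 b b0|h].
  have : ereal_inf A < b%:E by rewrite A_0 lte_fin.
  by move=> /ereal_inf_lt[y Ay yb]; exists y => //; exact: ltW.
apply/eqP; rewrite eq_le; apply/andP; split; last exact: le_ereal_inf_tmp.
apply/lee_addgt0Pr => b /h[y Ay yb]; rewrite add0e.
by apply: le_trans yb; exact: ereal_inf_lbound.
Qed.

End Esum.

(** The Caratheodory-Pesin scheme: [I] names the admissible pieces, [S i] is
    the set covered by the piece [i], and [w i] is its cost. Hausdorff null
    sets and the null sets of [m_BS] and [m_P] are all of this form. *)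
Definition null_cover {R : realType} {X : Type} {I : choiceType}
    (S : I -> set X) (D : set I) (w : I -> \bar R) (Z : set X) : Prop :=
  forall b : R, 0 < b -> exists F : set I,
    [/\ countable F, F `<=` D, Z `<=` \bigcup_(i in F) S i &
        (\esum_(i in F) w i <= b%:E)%E].

Section NullCover.
Context {R : realType} {X : Type}.
Local Open Scope ereal_scope.

Lemma null_cover_subset (I : choiceType) (S : I -> set X) D (w : I -> \bar R)
    (Y Z : set X) :
  Y `<=` Z -> null_cover S D w Z -> null_cover S D w Y.
Proof.
move=> YZ nZ b /nZ[F [cF FD ZF Fb]]; exists F; split=> //.
exact: subset_trans ZF.
Qed.

Lemma null_cover_bigcup (I : choiceType) (S : I -> set X) D (w : I -> \bar R)
    (A : nat -> set X) (Z : set X) : (forall i, 0 <= w i) ->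
  (forall k, null_cover S D w (A k)) -> Z `<=` \bigcup_k A k ->
  null_cover S D w Z.
Proof.
move=> w0 nA ZA b b0.
have bk k : (0 < b / (2 ^ k.+1)%:R)%R by rewrite divr_gt0// ltr0n expn_gt0.
have /choice[F FP] : forall k, exists F : set I, [/\ countable F, F `<=` D,
    A k `<=` \bigcup_(i in F) S i &
    \esum_(i in F) w i <= (b / (2 ^ k.+1)%:R)%:E].
  by move=> k; exact: nA.
exists (\bigcup_k F k); split.
- by apply: bigcup_countable => // k _; have [] := FP k.
- by move=> i [k _]; have [_ + _ _] := FP k; exact.
- move=> x /ZA[k _ Ax]; have [_ _ /(_ _ Ax)[i Fi Six] _] := FP k.
  by exists i => //; exists k.
- apply: (le_trans (esum_bigcup_le _ w0)).
  apply: (@le_trans _ _ (\sum_(k <oo) (b / (2 ^ k.+1)%:R)%:E)).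
    apply: lee_nneseries => [k _ _|k _]; first by rewrite esum_ge0.
    by have [] := FP k.
  exact: epsilon_trick0 (ltW b0).
Qed.

(** The additive error in the comparison of costs is what lets a piece of cost
    zero be replaced by one of positive cost. *)
Lemma null_cover_transfer (I J : choiceType) (S : I -> set X) D
    (w : I -> \bar R) (S' : J -> set X) D' (w' : J -> \bar R) (Z : set X)
    (K : R) : (0 <= K)%R -> (forall i, 0 <= w i) -> (forall j, 0 <= w' j) ->
  (forall i, D i -> (S i `&` Z) !=set0 -> forall b : R, (0 < b)%R ->
     exists j, [/\ D' j, S i `&` Z `<=` S' j & w' j <= K%:E * w i + b%:E]) ->
  null_cover S D w Z -> null_cover S' D' w' Z.
Proof.
move=> K0 w0 w'0 SS' nZ b b0.
have b' : (0 < b / 2 / (K + 1))%R by rewrite !divr_gt0// ltr_wpDl.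
have [F [cF FD ZF Fb]] := nZ _ b'.
pose F0 := F `&` [set i | (S i `&` Z) !=set0].
have [F00|/set0P[i0 [Fi0 Si0]]] := eqVneq F0 set0.
  exists set0; split=> //; rewrite ?esum_set0 ?lee_fin ?(ltW b0)//.
  move=> x Zx; have [i Fi Six] := ZF _ Zx.
  have : F0 i by split=> //; exists x.
  by rewrite F00.
have [j0 _] := SS' _ (FD _ Fi0) Si0 1%R ltr01.
have [f finj] := countable_injP _ cF.
pose e n := (b / 2 / (2 ^ n.+1)%:R)%R.
have e0 n : (0 < e n)%R by rewrite !divr_gt0// ltr0n expn_gt0.
have /choice[g gP] : forall i, exists j, F0 i ->
    [/\ D' j, S i `&` Z `<=` S' j & w' j <= K%:E * w i + (e (f i))%:E].
  move=> i; have [[Fi Si]|nF] := pselect (F0 i); last by exists j0 => /nF.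
  by have [j hj] := SS' _ (FD _ Fi) Si _ (e0 (f i)); exists j.
exists (g @` F0); split.
- apply: (sub_countable (card_image_le _ _)); apply: (sub_countable _ cF).
  by apply: subset_card_le; exact: subIsetl.
- by move=> _ [i /gP[+ _ _] <-].
- move=> x Zx; have [i Fi Six] := ZF _ Zx.
  have F0i : F0 i by split=> //; exists x.
  by exists (g i); [exists i|have [_ + _] := gP _ F0i; apply].
- apply: (le_trans (esum_image_le _ _ _)).
  apply: (@le_trans _ _ (\esum_(i in F0) (K%:E * w i + (e (f i))%:E))).
    by apply: le_esum => i /gP[].
  rewrite esumD; last 2 first.
    by move=> i _; rewrite mule_ge0.
    by move=> i _; rewrite lee_fin ltW.
  rewrite (splitr b) EFinD leeD//.
    apply: (le_trans (esumZ_le _ K0 w0)).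
    apply: (@le_trans _ _ (K%:E * (b / 2 / (K + 1))%:E)).
      rewrite lee_pmul// ?esum_ge0//; apply: le_trans Fb.
      by apply: esum_subset; exact: subIsetl.
    rewrite -EFinM lee_fin mulrCA ler_piMr ?divr_ge0 ?(ltW b0)//.
    by rewrite ler_pdivrMr ?mul1r ?lerDl// ltr_wpDl.
  rewrite -(esum_image F0 f (fun n => (e n)%:E)); last first.
    by move=> i k; rewrite !inE => -[Fi _] [Fk _]; apply: finj; rewrite inE.
  apply: (le_trans (esum_subset _ (@subsetT _ _))).
  rewrite -nneseries_esumT; last by move=> n; rewrite lee_fin ltW.
  by apply: epsilon_trick0; rewrite divr_ge0 ?(ltW b0).
Qed.

End NullCover.

(** * Null sets of Hausdorff and packing measures *)

Section EReal.
Context {R : realType}.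
Local Open Scope ereal_scope.

Lemma lee_EFin_above (x y : \bar R) :
  (forall s : R, y < s%:E -> x <= s%:E) -> x <= y.
Proof.
case: y => [y| |] h; last 2 first.
- exact: leey.
- case: x h => [x| |] h //.
    by have := h (x - 1)%R (ltNyr _); rewrite lee_fin => x1; exfalso; lra.
  by have := h 0%R (ltNyr _).
apply/lee_addgt0Pr => e e0; rewrite -EFinD; apply: h.
by rewrite lte_fin ltrDl.
Qed.

Lemma ereal_sup_image_eq0P (I : Type) (D : set I) (f : I -> \bar R) : D !=set0 ->
  (forall x, D x -> 0 <= f x) ->
  ereal_sup (f @` D) = 0 <-> forall x, D x -> f x = 0.
Proof.
move=> [x0 Dx0] f0; split=> [fs x Dx|h].
  by apply/eqP; rewrite eq_le f0// -fs andbT ereal_sup_ubound//; exists x.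
apply/eqP; rewrite eq_le; apply/andP; split.
  by apply: ge_ereal_sup => _ [x Dx <-]; rewrite h.
by apply: ereal_sup_ubound; exists x0 => //; exact: h.
Qed.

End EReal.

(** Packing dimension, [Dim_BS] and the upper pressure are all obtained by
    letting [Z] be a countable union of sets that satisfy a bound [Q]. *)
Definition sigma_cover {X : Type} (Q : set (set X)) (Z : set X) : Prop :=
  exists2 A : nat -> set X, Z `<=` \bigcup_i A i & forall i, Q (A i).

Section SigmaCover.
Context {X : Type}.

Lemma sigma_cover_bigcup (Q : set (set X)) (B : nat -> set X) (Z : set X) :
  (forall k, sigma_cover Q (B k)) -> Z `<=` \bigcup_k B k -> sigma_cover Q Z.
Proof.
move=> QB ZB.
have /choice[A AP] : forall k, exists A : nat -> set X,
    B k `<=` \bigcup_i A i /\ forall i, Q (A i).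
  by move=> k; have [A BA QA] := QB k; exists A.
pose idx n := odflt (0, 0)%N (unpickle n).
exists (fun n => A (idx n).1 (idx n).2); last by move=> i; have [_] := AP (idx i).1.
move=> x /ZB[k _ /(AP k).1[i _ Aki]]; exists (pickle (k, i)) => //=.
by rewrite /idx pickleK.
Qed.

Lemma sigma_cover_sub (Q Q' : set (set X)) (Z Z' : set X) :
  Q `<=` Q' -> Z' `<=` Z -> sigma_cover Q Z -> sigma_cover Q' Z'.
Proof.
move=> QQ' ZZ' [A ZA QA]; exists A; first exact: subset_trans ZA.
by move=> i; apply: QQ'.
Qed.

End SigmaCover.

Section Measures.
Context {R : realType} {X : metricType R}.
Implicit Types (Z U : set X) (s delta : R).
Local Open Scope ereal_scope.

Lemma diam_ge0 U : 0 <= diam U.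
Proof. by apply: ereal_sup_ubound; left. Qed.

Lemma mdist_le_diam U x y : U x -> U y -> (mdist x y)%:E <= diam U.
Proof.
by move=> Ux Uy; apply: ereal_sup_ubound; right; exists (x, y).
Qed.

Lemma diam_le U (r : R) : (0 <= r)%R ->
  (forall x y, U x -> U y -> (mdist x y <= r)%R) -> diam U <= r%:E.
Proof.
move=> r0 Ur; apply: ge_ereal_sup => _ [->|[[x y] [Ux Uy] <-]].
  by rewrite lee_fin.
by rewrite lee_fin; exact: Ur.
Qed.

Definition hausdorff_null s Z : Prop := forall delta : R, (0 < delta)%R ->
  null_cover (fun U : set X => U) [set U | diam U <= delta%:E]
    (fun U => diam U `^ s) Z.

Lemma hausdorff_measure_eq0P s Z :
  hausdorff_measure s Z = 0 <-> hausdorff_null s Z.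
Proof.
have pos (d : R) : forall y, [set \esum_(U in C) (diam U `^ s) | C in
    [set C : set (set X) | [/\ countable C,
       forall U, C U -> diam U <= d%:E & Z `<=` \bigcup_(U in C) U]]] y ->
    0 <= y.
  by move=> _ [C _ <-]; apply: esum_ge0 => U _; exact: poweR_ge0.
rewrite /hausdorff_measure lim_at0_sup; last first.
  move=> x y x0 xy; apply: ereal_inf_le_tmp => _ [C [cC Cx ZC] <-].
  by exists C => //; split=> // U /Cx/le_trans; apply; rewrite lee_fin.
rewrite ereal_sup_image_eq0P; last 2 first.
- by exists 1%R => /=.
- by move=> d d0; apply: le_ereal_inf_tmp => y; exact: pos.
split=> h d d0.
  move=> b b0; have /(ereal_inf_eq0P (pos d))/(_ _ b0) := h d d0.
  by move=> [_ [C [cC Cd ZC] <-] Cb]; exists C.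
apply/(ereal_inf_eq0P (pos d)) => b b0; have [C [cC Cd ZC Cb]] := h d d0 _ b0.
by exists (\esum_(U in C) (diam U `^ s)) => //; exists C.
Qed.

Lemma hausdorff_null_bigcup s (A : nat -> set X) Z :
  (forall k, hausdorff_null s (A k)) -> Z `<=` \bigcup_k A k ->
  hausdorff_null s Z.
Proof.
move=> nA ZA d d0; apply: null_cover_bigcup ZA => [U|k]; first exact: poweR_ge0.
exact: nA.
Qed.

Lemma hausdorff_null0 Z : hausdorff_null 0 Z -> Z = set0.
Proof.
move=> /(_ 1%R ltr01 2^-1%R); rewrite invr_gt0 => /(_ (ltr0n R 2))[C [_ _ ZC]].
rewrite leNgt => /negP C1; apply/seteqP; split=> // x /ZC[U CU Ux].
apply: C1; apply: (@lt_le_trans _ _ (\esum_(U in [set U]) (diam U `^ 0))).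
  by rewrite esum_set1 ?poweRe0// lte_fin invf_lt1// ltr1n.
by apply: esum_subset => _ ->.
Qed.

Lemma dim_H_le s Z : (0 <= s)%R -> hausdorff_null s Z -> dim_H Z <= s%:E.
Proof.
move=> s0 /hausdorff_measure_eq0P sZ; apply: ereal_inf_lbound.
by exists s.
Qed.

Lemma dim_H_lt s Z : dim_H Z < s%:E ->
  exists s0 : R, [/\ (0 <= s0)%R, (s0 < s)%R & hausdorff_null s0 Z].
Proof.
move=> /ereal_inf_lt[_ [s0 [s00 /hausdorff_measure_eq0P nZ] <-] s0s].
by exists s0.
Qed.

Lemma packing_limitE s Z : packing_limit s Z =
  ereal_inf ((fun d => packing_premeasure s d Z) @` [set d | (0 < d)%R]).
Proof.
apply: lim_at0_inf => x y x0 xy.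
apply: ereal_sup_le => _ [F [cF Fx tF] <-]; exists F => //; split=> // p /Fx.
by move=> [Zp /andP[p0 px]]; split=> //; rewrite p0 (le_trans px).
Qed.

Lemma packing_premeasure_ge0 s delta Z : 0 <= packing_premeasure s delta Z.
Proof.
apply: ereal_sup_ubound; exists set0; [|by rewrite esum_set0].
by split; [exact: countable0 | move=> p | move=> p q].
Qed.

Lemma packing_limit_ge0 s Z : 0 <= packing_limit s Z.
Proof.
rewrite packing_limitE; apply: le_ereal_inf_tmp => _ [d _ <-].
exact: packing_premeasure_ge0.
Qed.

Lemma packing_limit_eq0 s Z : (forall b : R, (0 < b)%R ->
    exists2 d : R, (0 < d)%R & packing_premeasure s d Z <= b%:E) ->
  packing_limit s Z = 0.
Proof.
move=> h; apply/eqP; rewrite eq_le packing_limit_ge0 andbT.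
apply/lee_addgt0Pr => b /h[d d0 db]; rewrite add0e; apply: le_trans db.
by rewrite packing_limitE; apply: ereal_inf_lbound; exists d.
Qed.

Lemma packing_limit_lty s Z : packing_limit s Z < +oo ->
  exists2 d : R, (0 < d)%R & packing_premeasure s d Z < +oo.
Proof. by rewrite packing_limitE => /ereal_inf_lt[_ [d d0 <-]]; exists d. Qed.

Lemma packing_limit0 Z : packing_limit 0 Z = 0 -> Z = set0.
Proof.
move=> Z0; apply/seteqP; split=> // x Zx.
suff : 1 <= packing_limit 0 Z by rewrite Z0 lee_fin ler10.
rewrite packing_limitE; apply: le_ereal_inf_tmp => _ [d d0 <-].
apply: ereal_sup_ubound; exists [set (x, d)].
  split; first exact: countable1.
    by move=> _ -> /=; split=> //; rewrite lexx andbT.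
  by move=> p q -> ->.
by rewrite esum_set1 /= ?powRr0.
Qed.

Lemma packing_measure_eq0 s Z :
  sigma_cover (fun A => packing_limit s A = 0) Z -> packing_measure s Z = 0.
Proof.
move=> [A ZA A0]; apply/eqP; rewrite eq_le; apply/andP; split.
  apply: ereal_inf_lbound; exists A => //; apply: eseries0 => i _ _.
  exact: A0.
apply: le_ereal_inf_tmp => _ [B _ <-]; apply: nneseries_ge0 => i _ _.
exact: packing_limit_ge0.
Qed.

Lemma packing_measure_lty s Z : packing_measure s Z = 0 ->
  sigma_cover (fun A => packing_limit s A < +oo) Z.
Proof.
move=> Z0; have : packing_measure s Z < +oo by rewrite Z0.
move=> /ereal_inf_lt[_ [A ZA <-] Afin]; exists A => // i; apply: le_lt_trans Afin.
rewrite (@nneseriesD1 _ _ i)//; last by move=> k _; exact: packing_limit_ge0.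
by rewrite leeDl// nneseries_ge0// => k _ _; exact: packing_limit_ge0.
Qed.

Lemma dim_P_le s Z : (0 <= s)%R ->
  sigma_cover (fun A => packing_limit s A = 0) Z -> dim_P Z <= s%:E.
Proof.
by move=> s0 /packing_measure_eq0 sZ; apply: ereal_inf_lbound; exists s.
Qed.

Lemma dim_P_lt s Z : dim_P Z < s%:E ->
  exists s0 : R, [/\ (0 <= s0)%R, (s0 < s)%R &
    sigma_cover (fun A => packing_limit s0 A < +oo) Z].
Proof.
move=> /ereal_inf_lt[_ [s0 [s00 /packing_measure_lty nZ] <-] s0s].
by exists s0.
Qed.

End Measures.

(** * Distortion along orbits *)

Section Orbits.
Context {R : realType} {X : metricType R}.
Variable T : X -> X.
Implicit Types (x y : X) (f : X -> R) (n k : nat) (e eps : R).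

Lemma birkhoff0 f x : birkhoff T f 0 x = 0.
Proof. by rewrite /birkhoff big_ord0. Qed.

Lemma birkhoffS f n x :
  birkhoff T f n.+1 x = birkhoff T f n x + f (iter n T x).
Proof. by rewrite /birkhoff big_ord_recr. Qed.

Lemma birkhoffD f k m x :
  birkhoff T f (k + m) x = birkhoff T f k x + birkhoff T f m (iter k T x).
Proof.
rewrite /birkhoff big_split_ord/=; congr (_ + _).
by apply: eq_bigr => i _ /=; rewrite addnC iterD.
Qed.

Lemma birkhoffZ f (c : R) n x :
  birkhoff T (fun z => c * f z) n x = c * birkhoff T f n x.
Proof. by rewrite /birkhoff mulr_sumr. Qed.

Lemma bowen_ball_self n x eps : 0 < eps -> bowen_ball T n x eps x.
Proof. by move=> e0 i _; rewrite mdistxx. Qed.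

Lemma bowen_ball_sym n x y eps :
  bowen_ball T n x eps y -> bowen_ball T n y eps x.
Proof. by move=> xy i /xy; rewrite metric_sym. Qed.

Lemma bowen_ball_triangle n x y z eps :
  bowen_ball T n x eps y -> bowen_ball T n y eps z ->
  bowen_ball T n x (2 * eps) z.
Proof.
move=> xy yz i iN; rewrite mulr_natl mulr2n.
apply: (le_lt_trans (metric_triangle _ (iter i T y) _)).
by rewrite ltrD// ?xy ?yz.
Qed.

Lemma bowen_ball_le n x eps eps' : eps <= eps' ->
  bowen_ball T n x eps `<=` bowen_ball T n x eps'.
Proof. by move=> ee y xy i /xy /lt_le_trans; exact. Qed.

Lemma bowen_ball_leq m n x eps : (m <= n)%N ->
  bowen_ball T n x eps `<=` bowen_ball T m x eps.
Proof. by move=> mn y xy i im; apply: xy; exact: leq_trans mn. Qed.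

(** Conformality enters the comparison of Bowen balls with metric balls through
    this estimate, which, unlike a limit at each point, can be iterated along
    an orbit. *)
Definition distortion (u : X -> R) e eps : Prop := forall x y,
  mdist x y < eps ->
  [/\ mdist (T x) (T y) <= mdist x y * exp2 (u x + e),
      mdist x y * exp2 (u x - e) <= mdist (T x) (T y) &
      `|u x - u y| <= e].

Lemma distortion_le (u : X -> R) e eps eps' : eps' <= eps ->
  distortion u e eps -> distortion u e eps'.
Proof. by move=> ee D x y xy; apply: D; exact: lt_le_trans ee. Qed.

Lemma conformal_distortion (a : X -> R) : conformal T a ->
  forall e, 0 < e -> exists2 eps : R, 0 < eps &
    distortion (fun x => log2 (a x)) e eps.
Proof.
move=> [_ _ [r0 r00 [Tpos zeta_uc]]] e e0.
have [d d0 dP] := zeta_uc _ e0.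
exists (Num.min r0 d) => [|x y]; first by rewrite lt_min r00.
rewrite lt_min => /andP[xyr xyd].
(* Both estimates compare [zeta] with its diagonal value [zeta x x = u x]. *)
have uxy : `|log2 (a x) - log2 (a y)| <= e.
  have := dP x x y y; rewrite !mdistxx /zeta !eqxx => /(_ r00 r00 xyd xyd).
  exact: ltW.
have [<-|xy] := eqVneq x y.
  by rewrite !mdistxx !mul0r subrr normr0 (ltW e0).
have := dP x y x x; rewrite !mdistxx (metric_sym y x) /zeta eqxx (negbTE xy).
move=> /(_ xyr r00 d0 xyd) /ltW; rewrite ler_norml => /andP[lo up].
have xy0 : 0 < mdist x y by rewrite mdist_gt0.
have Txy0 := Tpos _ _ xy xyr.
by split=> //; rewrite ?le_mul_exp2 ?mul_exp2_le//; lra.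
Qed.

Variable u : X -> R.
Local Notation S := (birkhoff T u).

Lemma birkhoff_close f e eps n x y :
  (forall x' y', mdist x' y' < eps -> `|f x' - f y'| <= e) ->
  bowen_ball T n x eps y -> `|birkhoff T f n x - birkhoff T f n y| <= n%:R * e.
Proof.
move=> D; elim: n => [|n IH] xy; first by rewrite !birkhoff0 subrr normr0 mul0r.
have := D _ _ (xy n (ltnSn n)).
have := IH (bowen_ball_leq (leqnSn n) xy).
rewrite !birkhoffS !ler_norml -natr1 mulrDl mul1r => /andP[? ?] /andP[? ?].
by apply/andP; split; lra.
Qed.

Lemma iter_distortion e eps k x y : distortion u e eps ->
  bowen_ball T k x eps y ->
  mdist x y * exp2 (S k x - k%:R * e) <= mdist (iter k T x) (iter k T y)
    <= mdist x y * exp2 (S k x + k%:R * e).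
Proof.
move=> D; elim: k => [|k IH] xy.
  by rewrite birkhoff0 mul0r subr0 addr0 exp2_0 mulr1 lexx.
have [Dup Dlo _] := D _ _ (xy k (ltnSn k)).
have /andP[lo up] := IH (bowen_ball_leq (leqnSn k) xy).
apply/andP; split.
  apply: le_trans Dlo; apply: le_trans (ler_wpM2r (exp2_ge0 _) lo).
  by rewrite -mulrA -exp2D ler_wpM2l ?mdist_ge0// ler_exp2 birkhoffS -natr1; lra.
apply: (le_trans Dup); apply: (le_trans (ler_wpM2r (exp2_ge0 _) up)).
by rewrite -mulrA -exp2D ler_wpM2l ?mdist_ge0// ler_exp2 birkhoffS -natr1; lra.
Qed.

(** Uniform versions of positive exponents, sublinear growth and tempered
    contraction; [Z] is a countable union of such pieces. *)
Definition regular (c e K : R) x : Prop :=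
  [/\ forall n, n%:R * c - K <= S n x,
      forall n, `|u (iter n T x)| <= K + n%:R * e &
      forall n k, (k <= n)%N -> - K - n%:R * e <= S (n - k) (iter k T x)].

(** The last factor of the derivative along the orbit is not controlled by the
    Bowen ball; sublinear growth makes it negligible. *)
Lemma bowen_ball_mdist_le c e K eps n x y :
  distortion u e eps -> 0 < e -> regular c e K x -> (0 < n)%N ->
  bowen_ball T n x eps y ->
  mdist x y <= eps * exp2 (K + 2 * n%:R * e - S n x).
Proof.
move=> D e0 [_ G2 _]; case: n => // n _ xy.
have /andP[lo _] := iter_distortion D (bowen_ball_leq (leqnSn n) xy).
have {}lo : mdist x y * exp2 (S n x - n%:R * e) <= eps.
  exact: le_trans lo (ltW (xy n (ltnSn n))).
move: lo; rewrite -ler_pdivlMr ?exp2_gt0// -exp2N => /le_trans; apply.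
have eps0 : 0 < eps by apply: le_lt_trans (xy n (ltnSn n)); exact: mdist_ge0.
rewrite ler_wpM2l ?(ltW eps0)// ler_exp2 birkhoffS.
have := G2 n; rewrite ler_norml => /andP[_ ?].
have ne0 : 0 <= n%:R * e by rewrite mulr_ge0// ltW.
by rewrite -natr1; lra.
Qed.

(** Tempered contraction keeps the intermediate iterates of a ball of radius
    comparable with [exp2 (- S n x)] below the scale [eps]. *)
Lemma ball_sub_bowen_ball c e K eps n x y :
  distortion u e eps -> 0 < e -> 0 < eps -> regular c e K x ->
  mdist x y < eps * exp2 (- (K + 2 * n%:R * e + S n x)) ->
  bowen_ball T n x eps y.
Proof.
move=> D e0 eps0 [_ _ G3] xy.
suff h k : (k <= n)%N -> bowen_ball T k x eps y by exact: h.
elim: k => [//|k IH] kn i; rewrite ltnS leq_eqVlt => /orP[/eqP->|]; last first.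
  by apply: IH; exact: ltnW.
have /andP[_ up] := iter_distortion D (IH (ltnW kn)).
apply: (le_lt_trans up).
apply: (@lt_le_trans _ _ (eps * exp2 (- (K + 2 * n%:R * e + S n x)) *
    exp2 (S k x + k%:R * e))); first by rewrite ltr_pM2r ?exp2_gt0.
rewrite -mulrA -exp2D ler_piMr ?(ltW eps0)// -[leRHS]exp2_0 ler_exp2.
have -> : S n x = S k x + S (n - k) (iter k T x).
  by rewrite -birkhoffD subnKC// ltnW.
have := G3 n k (ltnW kn).
have : k%:R * e <= n%:R * e by rewrite ler_wpM2r ?(ltW e0)// ler_nat ltnW.
move=> ? ?; lra.
Qed.

Lemma regular_ge0 c e K x : regular c e K x -> 0 <= K.
Proof. by move=> [G1 _ _]; have := G1 0%N; rewrite birkhoff0 => ?; lra. Qed.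

Lemma regular_birkhoff_le c e K N n x : 0 < e -> regular c e K x ->
  (n <= N)%N -> S n x <= N%:R * (K + N%:R * e).
Proof.
move=> e0 G nN; have K0 := regular_ge0 G; have [_ G2 _] := G.
have h m : (m <= N)%N -> S m x <= m%:R * (K + N%:R * e).
  elim: m => [|m IH] mN; first by rewrite birkhoff0 mul0r.
  rewrite birkhoffS -natr1 mulrDl mul1r lerD ?IH 1?ltnW//.
  apply: (le_trans (ler_norm _)); apply: (le_trans (G2 m)).
  by rewrite lerD2l ler_wpM2r ?(ltW e0)// ler_nat ltnW.
apply: (le_trans (h _ nN)).
by rewrite ler_wpM2r ?ler_nat// addr_ge0// mulr_ge0// ltW.
Qed.

Lemma first_crossing (h : nat -> R) (L : R) (N : nat) :
  (forall n, (n <= N)%N -> h n < L) -> (exists p, L <= h p) ->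
  exists n, [/\ (N <= n)%N, h n < L & L <= h n.+1].
Proof.
move=> hN ex; case: (ex_minnP ex) => -[|p] Lp minp.
  by have := hN 0%N (leq0n _); rewrite ltNge Lp.
exists p; split=> //; last first.
  by rewrite ltNge; apply/negP => /minp; rewrite ltnn.
by rewrite leqNgt; apply/negP => /hN; rewrite ltNge Lp.
Qed.

Lemma linear_unbounded (c b L : R) : 0 < c -> exists p, L <= p%:R * c - b.
Proof.
move=> c0; exists (Num.bound `|(L + b) / c|); rewrite lerBrDr -ler_pdivrMr//.
apply: (le_trans (ler_norm _)); apply: ltW.
exact: archi_boundP (normr_ge0 _).
Qed.

(** The exponent [K + 2 * n%:R * e + S n x] tends to infinity with steps that
    are at most linear in [n] with small slope, so it crosses the level [log2
    (eps / r)] with an overshoot that is subexponential for the radii. *)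
Lemma inner_scale c e K eps N : 0 < c -> 0 < e -> 0 < eps ->
  exists2 rho : R, 0 < rho & forall x r, regular c e K x -> 0 < r < rho ->
  exists n, [/\ (N <= n)%N, r < eps * exp2 (- (K + 2 * n%:R * e + S n x)) &
    eps * exp2 (- (2 * K + 2 * e + 3 * n%:R * e + S n x)) <= r].
Proof.
move=> c0 e0 eps0.
exists (eps * exp2 (- (K + 2 * N%:R * e + N%:R * (K + N%:R * e)))).
  by rewrite mulr_gt0// exp2_gt0.
move=> x r G /andP[r0 rrho]; have [G1 G2 _] := G.
pose h n := K + 2 * n%:R * e + S n x.
pose L := log2 (eps / r).
have er0 : 0 < eps / r by rewrite divr_gt0.
have hL (b : R) : (r < eps * exp2 (- b)) = (b < L).
  rewrite exp2N ltr_pdivlMr ?exp2_gt0// mulrC -ltr_pdivlMr//.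
  by rewrite -(log2K er0) ltr_exp2.
have hL' b : (eps * exp2 (- b) <= r) = (L <= b).
  by rewrite leNgt hL -leNgt.
have [n [Nn hn Ln]] : exists n, [/\ (N <= n)%N, h n < L & L <= h n.+1].
  apply: first_crossing => [n nN|].
    move: rrho; rewrite hL; apply: le_lt_trans.
    have := regular_birkhoff_le e0 G nN.
    have : n%:R * e <= N%:R * e by rewrite ler_wpM2r ?(ltW e0)// ler_nat.
    by rewrite /h => ? ?; lra.
  have [p Lp] := linear_unbounded 0 L c0; exists p; rewrite /h.
  have := G1 p; have : 0 <= p%:R * e by rewrite mulr_ge0// ltW.
  by move=> ? ?; lra.
exists n; rewrite hL hL'; split=> //.
apply: (le_trans Ln); rewrite /h birkhoffS -natr1.
have := G2 n; rewrite ler_norml => /andP[_ ?].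
lra.
Qed.

(** The dual choice of an order, for which the metric ball contains the Bowen
    ball instead; the factor [2] is room for recentering Bowen balls at points
    of the set under study. *)
Lemma outer_scale c e K eps N : 2 * e < c -> 0 < e -> 0 < eps ->
  exists2 rho : R, 0 < rho & forall x r, regular c e K x -> 0 < r < rho ->
  exists n, [/\ (N < n)%N, 2 * eps * exp2 (K + 2 * n%:R * e - S n x) <= r &
    r <= eps * exp2 (2 * K + 1 + 3 * n%:R * e - S n x)].
Proof.
move=> ec e0 eps0.
exists (eps * exp2 (- (N%:R * (K + N%:R * e)))).
  by rewrite mulr_gt0// exp2_gt0.
move=> x r G /andP[r0 rrho]; have [G1 G2 _] := G; have K0 := regular_ge0 G.
pose h n := S n x - K - 2 * n%:R * e - 1.
pose L := log2 (eps / r).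
have er0 : 0 < eps / r by rewrite divr_gt0.
have hL (b : R) : (r < eps * exp2 (- b)) = (b < L).
  rewrite exp2N ltr_pdivlMr ?exp2_gt0// mulrC -ltr_pdivlMr//.
  by rewrite -(log2K er0) ltr_exp2.
have hL' b : (eps * exp2 (- b) <= r) = (L <= b) by rewrite leNgt hL -leNgt.
have [n [Nn hn Ln]] : exists n, [/\ (N <= n)%N, h n < L & L <= h n.+1].
  apply: first_crossing => [n nN|].
    move: rrho; rewrite hL; apply: le_lt_trans.
    have := regular_birkhoff_le e0 G nN.
    have : 0 <= n%:R * e by rewrite mulr_ge0// ltW.
    by rewrite /h; lra.
  have ec0 : 0 < c - 2 * e by lra.
  have [p Lp] := linear_unbounded (2 * K + 1) L ec0; exists p; rewrite /h.
  by have := G1 p => ?; lra.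
exists n.+1; split=> //.
  have -> : 2 * eps * exp2 (K + 2 * n.+1%:R * e - S n.+1 x) =
            eps * exp2 (- h n.+1).
    rewrite -{1}exp2_1 mulrAC [_ * eps]mulrC -exp2D; congr (_ * exp2 _).
    by rewrite /h; lra.
  by rewrite hL'.
apply: ltW; have -> : 2 * K + 1 + 3 * n.+1%:R * e - S n.+1 x =
    - (S n.+1 x - 2 * K - 1 - 3 * n.+1%:R * e) by lra.
rewrite hL; apply: le_lt_trans hn; rewrite /h birkhoffS -natr1.
have := G2 n; rewrite ler_norml => /andP[_ ?].
lra.
Qed.

End Orbits.

(** * Comparison of covers and packings on a uniform piece *)

Section Comparison.
Context {R : realType} {X : metricType R}.
Variables (T : X -> X) (u : X -> R).
Local Notation S := (birkhoff T u).
Implicit Types (w : X * nat -> \bar R) (Y Z : set X).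

(** The two ways in which a weight of Bowen balls can be small on a set:
    through covers by balls of large but varying orders, as for [m_P] and
    [m_BS], or through spanning sets of a common order, as for [P_UC] and
    [dim_BSC]. *)
Definition bowen_null (eps : R) w Z : Prop := forall N : nat,
  null_cover (fun p => bowen_ball T p.2 p.1 eps)
    [set p : X * nat | (N <= p.2)%N] w Z.

Definition span_bounded (eps : R) w Z : Prop := exists (M : R) (N : nat),
  forall n, (N <= n)%N -> exists2 E : set X, spanning_sets T Z n eps E &
    (\esum_(x in E) w (x, n) <= M%:E)%E.

Lemma enlarge_radius (s D rho b : R) : 0 <= s -> 0 <= D -> 2 * D < rho ->
  0 < b -> exists r, [/\ D < r, r < rho & r `^ s <= 2 `^ s * D `^ s + b].
Proof.
move=> s0; rewrite le_eqVlt => /orP[/eqP<-|D0] Drho b0; last first.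
  exists (2 * D); split=> //; first lra.
  by rewrite powRM ?ler0n ?(ltW D0)// lerDl ltW.
move: s0; rewrite le_eqVlt => /orP[/eqP<-|s0].
  by exists (rho / 2); rewrite !powRr0 mulr1; split; lra.
exists (Num.min (rho / 2) (b `^ s^-1)).
rewrite mulr0 in Drho; split.
- by rewrite lt_min powR_gt0// divr_gt0.
- by rewrite gt_min ltr_pdivrMr// mulr_natr mulr2n ltrDl Drho.
- rewrite (@powR0 _ s) ?gt_eqF// mulr0 add0r.
  apply: (@le_trans _ _ ((b `^ s^-1) `^ s)).
    rewrite ge0_ler_powR ?(ltW s0) ?nnegrE ?powR_ge0 ?ge_min ?lexx ?orbT//.
    by rewrite le_min powR_ge0 divr_ge0 ?(ltW Drho).
  by rewrite -powRrM mulVf ?gt_eqF// powRr1// ltW.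
Qed.

(** A set that meets [Y] at [x] lies in the ball around [x] with twice its
    diameter as radius, and [inner_scale] puts that ball in a Bowen ball. Only
    a positive radius can be used, so sets of diameter zero are enlarged. *)
Lemma hausdorff_bowen_null_piece (c e K C theta s eps : R) w Y :
  distortion T u e eps -> 0 < c -> 0 < e -> 0 < eps -> 0 <= s ->
  3 * s * e <= theta -> (forall p, 0 <= w p)%E ->
  (forall x, Y x -> regular T u c e K x) ->
  (forall x n, Y x ->
    (w (x, n) <= (exp2 (C - n%:R * theta - s * S n x))%:E)%E) ->
  hausdorff_null s Y -> bowen_null eps w Y.
Proof.
move=> D c0 e0 eps0 s0 se w0 GY wY nY N.
have [rho rho0 rhoP] := @inner_scale R X T u c e K eps N c0 e0 eps0.
pose A := exp2 (C + s * (2 * K + 2 * e)) / eps `^ s.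
have es0 : 0 < eps `^ s by rewrite powR_gt0.
have A0 : 0 < A by rewrite divr_gt0// exp2_gt0.
have rho3 : 0 < rho / 3 by rewrite divr_gt0.
apply: (null_cover_transfer (K := A * 2 `^ s) _ _ _ _ (nY _ rho3)) => [||//|].
- by rewrite mulr_ge0 ?powR_ge0// ltW.
- by move=> U; exact: poweR_ge0.
move=> U /= Urho [x [Ux Yx]] b b0.
have Ufin : diam U \is a fin_num.
  by rewrite ge0_fin_numE ?diam_ge0// (le_lt_trans Urho)// ltry.
have D0 : 0 <= fine (diam U) by rewrite fine_ge0// diam_ge0.
have D2 : 2 * fine (diam U) < rho.
  have : fine (diam U) <= rho / 3 by rewrite -lee_fin fineK.
  by move=> ?; lra.
have [|r [Dr rrho rs]] := @enlarge_radius s _ rho (b / A) s0 D0 D2.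
  by rewrite divr_gt0.
have [|n [Nn rin rout]] := rhoP x r (GY x Yx); first by rewrite (le_lt_trans D0 Dr).
exists (x, n); split=> //= [y [Uy Yy]|].
  apply: (ball_sub_bowen_ball D e0 eps0 (GY x Yx)); apply: lt_trans rin.
  apply: le_lt_trans Dr; rewrite -lee_fin fineK//; exact: mdist_le_diam.
apply: (le_trans (wY x n Yx)).
rewrite -(fineK Ufin) poweR_EFin -EFinM -EFinD lee_fin.
apply: (@le_trans _ _ (A * r `^ s)); last first.
  apply: (le_trans (ler_wpM2l (ltW A0) rs)).
  by rewrite mulrDr mulrA lerD2l mulrCA divff ?gt_eqF// mulr1.
have : (eps * exp2 (- (2 * K + 2 * e + 3 * n%:R * e + S n x))) `^ s <= r `^ s.
  rewrite ge0_ler_powR// nnegrE; first by rewrite mulr_ge0 ?exp2_ge0// ltW.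
  by rewrite (le_trans D0)// ltW.
move/(ler_wpM2l (ltW A0)); apply: le_trans.
rewrite powRM ?exp2_ge0 ?(ltW eps0)// powR_exp2 mulrA.
rewrite [A * _]divfK ?gt_eqF//.
rewrite -exp2D ler_exp2.
have : n%:R * (3 * s * e) <= n%:R * theta by rewrite ler_wpM2l.
by move=> ?; lra.
Qed.


(** The Bowen ball itself serves as covering set: recentered at a point of [Y],
    where the derivative is under control, it has a small diameter. *)
Lemma bowen_hausdorff_null_piece (c e K C theta s eps : R) w Y :
  distortion T u e (2 * eps) -> 2 * e < c -> 0 < e -> 0 < eps -> 0 <= s ->
  2 * s * e <= theta -> (forall p, 0 <= w p)%E ->
  (forall x, Y x -> regular T u c e K x) ->
  (forall x y n, Y x -> bowen_ball T n y eps x ->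
    ((exp2 (- C + n%:R * theta - s * S n x))%:E <= w (y, n))%E) ->
  bowen_null eps w Y -> hausdorff_null s Y.
Proof.
move=> D ec e0 eps0 s0 se w0 GY wY nY delta delta0.
have ec0 : 0 < c - 2 * e by lra.
have [N NP] := linear_unbounded (2 * K) (log2 (4 * eps / delta)) ec0.
have eps4 : 0 < 4 * eps by lra.
pose A := (4 * eps) `^ s * exp2 (s * K + C).
have A0 : 0 <= A by rewrite mulr_ge0 ?powR_ge0 ?exp2_ge0.
apply: (null_cover_transfer (K := A) _ _ _ _ (nY N.+1)) => //.
  by move=> U; exact: poweR_ge0.
move=> [y n] /= Nn [x [yx Yx]] b b0; exists (bowen_ball T n y eps).
have n0 : (0 < n)%N by exact: leq_ltn_trans Nn.
pose rho := 4 * eps * exp2 (K + 2 * n%:R * e - S n x).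
have diam_ball : (diam (bowen_ball T n y eps) <= rho%:E)%E.
  have far z : bowen_ball T n y eps z ->
      mdist x z <= 2 * eps * exp2 (K + 2 * n%:R * e - S n x).
    move=> yz; apply: (bowen_ball_mdist_le D e0 (GY x Yx) n0).
    exact: bowen_ball_triangle (bowen_ball_sym yx) yz.
  apply: diam_le => [|z1 z2 /far h1 /far h2].
    by rewrite mulr_ge0 ?exp2_ge0// ltW.
  apply: (le_trans (metric_triangle _ x _)); rewrite (metric_sym z1) /rho.
  lra.
split=> //.
- apply: (le_trans diam_ball); rewrite lee_fin /rho.
  rewrite mul_exp2_le//; move: NP; rewrite log2_div// => NP.
  have [/(_ n) G1 _ _] := GY x Yx.
  have : N%:R * (c - 2 * e) <= n%:R * (c - 2 * e).
    by rewrite ler_wpM2r ?(ltW ec0)// ler_nat ltnW// ltnW.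
  by move=> ?; lra.
- apply: (@le_trans _ _ (A%:E * w (y, n))%E); last first.
    by rewrite leeDl// lee_fin ltW.
  apply: (@le_trans _ _ (rho%:E `^ s)%E).
    rewrite gt0_ler_poweR// in_itv/= leey andbT ?diam_ge0//.
    by rewrite lee_fin mulr_ge0 ?exp2_ge0// ltW.
  apply: (@le_trans _ _ (A%:E * (exp2 (- C + n%:R * theta - s * S n x))%:E)%E).
    rewrite poweR_EFin -EFinM lee_fin /rho powRM ?exp2_ge0 ?(ltW eps4)//.
    rewrite powR_exp2 /A -[leRHS]mulrA ler_wpM2l ?powR_ge0// -exp2D ler_exp2.
    have : n%:R * (2 * s * e) <= n%:R * theta by rewrite ler_wpM2l.
    by move=> ?; lra.
  by rewrite lee_pmul ?lee_fin ?exp2_ge0//; exact: wY.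
Qed.

Lemma countable_disjoint_cballs (E : set X) (r : X -> R) :
  separable_space X -> (forall x, E x -> 0 < r x) ->
  trivIset E (fun x => cball x (r x)) -> countable E.
Proof.
move=> [D cD dD] r0 tE.
have /choice[f fP] : forall x, exists y, E x -> D y /\ cball x (r x) y.
  move=> x; have [Ex|nE] := pselect (E x); last by exists x => /nE.
  have [||y [xy Dy]] := dD (interior (ball x (r x))).
  - by exists x; apply: nbhsx_ballx; exact: r0.
  - exact: open_interior.
  exists y => _; split=> //; move: xy => /interior_subset.
  by rewrite ballEmdist /= => /ltW.
have [g ginj] := countable_injP _ cD.
apply/countable_injP; exists (g \o f) => x y; rewrite !inE => Ex Ey /= gfxy.
have [Dx xf] := fP x Ex; have [Dy yf] := fP y Ey.
have fxy : f x = f y by apply: ginj; rewrite ?inE.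
by apply: tE => //; exists (f x); split=> //; rewrite fxy.
Qed.

(** The balls of a maximal packing, enlarged by a fixed factor, need not cover
    when the radii vary. Here they do: the centers of two balls that meet lie in
    a common Bowen ball, whichever radius is larger, because the Bowen metric is
    symmetric. *)
Lemma packing_span_bounded_piece (c e K C theta s eps delta : R) w Y :
  separable_space X ->
  distortion T u e eps -> 0 < c -> 0 < e -> 0 < eps -> 0 <= s -> 0 < delta ->
  2 * s * e <= theta -> (forall p, 0 <= w p)%E ->
  (forall x, Y x -> regular T u c e K x) ->
  (forall x n, Y x ->
    (w (x, n) <= (exp2 (C - n%:R * theta - s * S n x))%:E)%E) ->
  (packing_premeasure s delta Y < +oo)%E -> span_bounded eps w Y.
Proof.
move=> sep D c0 e0 eps0 s0 delta0 se w0 GY wY Yfin.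
set P := packing_premeasure s delta Y in Yfin.
have P0 : (0 <= P)%E by exact: packing_premeasure_ge0.
have Pfin : P \is a fin_num by rewrite ge0_fin_numE.
have [N NP] := linear_unbounded 0 (log2 (eps / delta)) c0.
pose A := exp2 (C + s * K) / (2 / 3 * eps) `^ s.
have eps23 : 0 < 2 / 3 * eps by lra.
have A0 : 0 <= A by rewrite divr_ge0 ?exp2_ge0 ?powR_ge0.
exists (A * fine P), N => n Nn.
pose r x := eps * exp2 (- (K + 2 * n%:R * e + S n x)) / 3.
have r0 x : 0 < r x by rewrite divr_gt0// mulr_gt0// exp2_gt0.
have ne0 : 0 <= n%:R * e by rewrite mulr_ge0// ltW.
have [E [EY tE maxE]] :=
  ex_maximal_disjoint_subcollection (fun x => cball x (r x)) Y.
have cE : countable E by apply: (countable_disjoint_cballs sep _ tE) => x _.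
exists E.
  split=> // y Yy; apply: contrapT => nEy.
  have nyE : ~ E y.
    by move=> Ey; apply: nEy; exists y => //; exact: bowen_ball_self.
  apply: (maxE (y |` E)).
  - split=> [|yE]; first exact: subsetUr.
    by apply: nyE; apply: yE; left.
  - by move=> z [->//|/EY].
  (* Otherwise [y] would lie in the Bowen ball of the center it meets. *)
  have sep_y x : E x -> cball x (r x) `&` cball y (r y) !=set0 -> False.
    move=> Ex [z []]; rewrite /cball/= => xz yz; apply: nEy; exists x => //.
    have xy : mdist x y <= r x + r y.
      apply: (le_trans (metric_triangle _ z _)).
      by rewrite lerD// metric_sym.
    have rE x' : 3 * r x' = eps * exp2 (- (K + 2 * n%:R * e + S n x')).
      by rewrite /r; lra.
    have := r0 x; have := r0 y => ry0 rx0.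
    have [rxy|ryx] := leP (r y) (r x).
      by apply: (ball_sub_bowen_ball D e0 eps0 (GY _ (EY _ Ex))); rewrite -rE; lra.
    apply: bowen_ball_sym; apply: (ball_sub_bowen_ball D e0 eps0 (GY _ Yy)).
    by rewrite -rE metric_sym; lra.
  move=> x1 x2 [->|Ex1] [->|Ex2] //.
  - by rewrite setIC => /(sep_y _ Ex2).
  - by move=> /(sep_y _ Ex1).
  - exact: tE.
apply: (@le_trans _ _ (\esum_(x in E) (A%:E * ((2 * r x) `^ s)%:E))%E).
  apply: le_esum => x Ex; apply: (le_trans (wY x n (EY _ Ex))).
  rewrite -EFinM lee_fin.
  have -> : 2 * r x = 2 / 3 * eps * exp2 (- (K + 2 * n%:R * e + S n x)).
    by rewrite /r; lra.
  rewrite powRM ?exp2_ge0 ?(ltW eps23)// powR_exp2 mulrA.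
  rewrite [A * _]divfK ?gt_eqF ?powR_gt0// -exp2D ler_exp2.
  have : n%:R * (2 * s * e) <= n%:R * theta by rewrite ler_wpM2l.
  by move=> ?; lra.
apply: (le_trans (esumZ_le _ A0 _)) => [x|]; first by rewrite lee_fin powR_ge0.
rewrite [(A * fine P)%:E]EFinM fineK// lee_pmul ?lee_fin ?esum_ge0// => [x _|].
  by rewrite lee_fin powR_ge0.
have inj : set_inj E (fun x => (x, r x)) by move=> x1 x2 _ _ [].
rewrite -(esum_image E (fun x => (x, r x))
  (fun p : X * R => ((2 * p.2) `^ s)%:E))//.
apply: ereal_sup_ubound; exists ((fun x => (x, r x)) @` E) => //; split.
- by apply: (sub_countable (card_image_le _ _)).
- move=> _ [x Ex <-] /=; split; first exact: EY.
  rewrite r0/=; apply: (@le_trans _ _ (eps * exp2 (- (K + 2 * n%:R * e + S n x)))).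
    by have := r0 x; rewrite /r => ?; lra.
  rewrite mul_exp2_le//; move: NP; rewrite log2_div// => NP.
  have [/(_ n) G1 _ _] := GY x (EY _ Ex).
  have : N%:R * c <= n%:R * c by rewrite ler_wpM2r ?(ltW c0)// ler_nat.
  by move=> ?; lra.
- move=> _ _ [x1 Ex1 <-] [x2 Ex2 <-] /= x12.
  by congr (_, r _); apply: tE.
Qed.

(** The points of a packing that share an order [n] lie in different Bowen
    balls of a spanning family of order [n], so the packing sum is bounded by
    the sum over all orders; the spare factor [exp2 (n * theta)] in the weights
    makes this series converge. *)
Lemma span_bounded_packing_piece (c e K C theta s eps : R) w Y :
  distortion T u e (2 * eps) -> 2 * e < c -> 0 < e -> 0 < eps -> 0 <= s ->
  0 < theta -> 6 * s * e <= theta -> (forall p, 0 <= w p)%E ->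
  (forall x, Y x -> regular T u c e K x) ->
  (forall x y n, Y x -> bowen_ball T n y eps x ->
    ((exp2 (- C + n%:R * theta - s * S n x))%:E <= w (y, n))%E) ->
  span_bounded eps w Y -> packing_limit s Y = 0%E.
Proof.
move=> D ec e0 eps0 s0 th0 se w0 GY wY [M [N0 MP]].
apply: packing_limit_eq0 => b b0.
have th4 : 0 < theta / 4 by rewrite divr_gt0.
have [G G0 GP] := geometric_nneseries_lt th4.
pose A := (2 * eps) `^ s * exp2 (s * (2 * K + 1) + C).
have A0 : 0 <= A by rewrite mulr_ge0 ?powR_ge0 ?exp2_ge0.
have /choice[E EP] : forall n, exists E : set X, (N0 <= n)%N ->
    spanning_sets T Y n eps E /\ (\esum_(x in E) w (x, n) <= M%:E)%E.
  move=> n; have [Nn|] := leqP N0 n; last by exists set0.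
  by have [E ? ?] := MP n Nn; exists E.
have [k kP] := linear_unbounded 0 (log2 ((A * `|M| * G + 1) / b)) th4.
pose N := maxn N0 k.
have [rho rho0 rhoP] := @outer_scale R X T u c e K eps N ec e0 eps0.
exists (rho / 2); first by rewrite divr_gt0.
apply: ge_ereal_sup => _ [F [cF FY tF] <-].
pose v (q : X * nat) := ((A * exp2 (- (q.2%:R * (theta / 2))))%:E * w q)%E.
have v0 q : (0 <= v q)%E by rewrite mule_ge0// lee_fin mulr_ge0// exp2_ge0.
have sel p : F p -> exists q : X * nat, [/\ (N < q.2)%N, E q.2 q.1,
    bowen_ball T q.2 q.1 eps p.1,
    2 * eps * exp2 (K + 2 * q.2%:R * e - S q.2 p.1) <= p.2 &
    p.2 <= eps * exp2 (2 * K + 1 + 3 * q.2%:R * e - S q.2 p.1)].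
  move=> Fp; have [Yp /andP[p0 prho]] := FY _ Fp.
  have [|n [Nn nlo nup]] := rhoP p.1 p.2 (GY _ Yp); first by rewrite p0; lra.
  have [|[_ YE] _] := EP n.
    by apply: leq_trans (ltnW Nn); rewrite leq_maxl.
  by have [y Ey yp] := YE _ Yp; exists (y, n).
have [->|/set0P[p0 Fp0]] := eqVneq F set0; first by rewrite esum_set0 lee_fin ltW.
have [q0 _] := sel _ Fp0.
have /choice[g gP] : forall p, exists q : X * nat, F p -> [/\ (N < q.2)%N,
    E q.2 q.1, bowen_ball T q.2 q.1 eps p.1,
    2 * eps * exp2 (K + 2 * q.2%:R * e - S q.2 p.1) <= p.2 &
    p.2 <= eps * exp2 (2 * K + 1 + 3 * q.2%:R * e - S q.2 p.1)].
  move=> p; have [/sel[q qP]|nF] := pselect (F p); first by exists q.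
  by exists q0 => /nF.
have ginj : set_inj F g.
  move=> p q; rewrite !inE => Fp Fq gpq.
  have [Np _ pp plo _] := gP p Fp; have [_ _ qq _ _] := gP q Fq.
  apply: tF => //; exists q.1; split; rewrite /cball/=; last first.
    by rewrite mdistxx; have [_ /andP[/ltW]] := FY _ Fq.
  apply: le_trans plo; have [Yp _] := FY _ Fp.
  apply: (bowen_ball_mdist_le D e0 (GY _ Yp)); first exact: leq_ltn_trans Np.
  by apply: bowen_ball_triangle (bowen_ball_sym pp) _; rewrite gpq.
apply: (@le_trans _ _ (\esum_(p in F) v (g p))%E).
  apply: le_esum => p Fp; have [_ _ pp _ pup] := gP p Fp.
  have [Yp /andP[p20 _]] := FY _ Fp.
  set n := (g p).2 in pp pup *.
  rewrite /v -/n; apply: (@le_trans _ _ ((A * exp2 (- (n%:R * (theta / 2))))%:E *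
      (exp2 (- C + n%:R * theta - s * S n p.1))%:E)%E); last first.
    rewrite lee_pmul ?lee_fin ?exp2_ge0 ?(mulr_ge0 A0 (exp2_ge0 _))//.
    by have := wY p.1 (g p).1 n Yp pp; rewrite /n -surjective_pairing.
  rewrite -EFinM lee_fin.
  apply: (@le_trans _ _
    ((2 * eps * exp2 (2 * K + 1 + 3 * n%:R * e - S n p.1)) `^ s)).
    rewrite ge0_ler_powR ?nnegrE//.
    + by rewrite mulr_ge0 ?ler0n// ltW.
    + by rewrite !mulr_ge0 ?exp2_ge0 ?ler0n// ltW.
    + by rewrite -mulrA ler_wpM2l.
  rewrite powRM ?exp2_ge0 ?mulr_ge0 ?ler0n ?(ltW eps0)// powR_exp2 /A.
  rewrite -!mulrA ler_wpM2l ?powR_ge0// -!exp2D ler_exp2.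
  have : n%:R * (6 * s * e) <= n%:R * theta by rewrite ler_wpM2l.
  by move=> ?; lra.
rewrite -(esum_image F g v ginj).
pose H n := if (N <= n)%N then (fun y => (y, n)) @` E n else set0.
apply: (@le_trans _ _ (\esum_(q in \bigcup_n H n) v q)%E).
  apply: esum_subset => _ [p Fp <-]; have [Np Ep _ _ _] := gP p Fp.
  exists (g p).2 => //; rewrite /H (ltnW Np); exists (g p).1 => //.
  by rewrite -surjective_pairing.
apply: (le_trans (esum_bigcup_le _ v0)).
pose B := A * `|M| * exp2 (- (N%:R * (theta / 4))).
have AM0 : 0 <= A * `|M| by rewrite mulr_ge0.
have B0 : 0 <= B by rewrite mulr_ge0 ?exp2_ge0.
apply: (@le_trans _ _
    (\sum_(n <oo) (B%:E * (exp2 (- (n%:R * (theta / 4))))%:E))%E).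
  apply: lee_nneseries => [n _ _|n _]; first by rewrite esum_ge0.
  rewrite /H; case: ifPn => Nn; last first.
    by rewrite esum_set0 mule_ge0// lee_fin ?exp2_ge0.
  apply: (le_trans (esum_image_le _ _ _)); rewrite /v/=.
  have An0 : 0 <= A * exp2 (- (n%:R * (theta / 2))) by rewrite mulr_ge0 ?exp2_ge0.
  apply: (le_trans (esumZ_le _ An0 _)) => //.
  apply: (@le_trans _ _ ((A * exp2 (- (n%:R * (theta / 2))))%:E * `|M|%:E)%E).
    rewrite lee_pmul ?lee_fin ?esum_ge0//.
    have [|_ /le_trans] := EP n; first by apply: leq_trans Nn; rewrite leq_maxl.
    by apply; rewrite lee_fin ler_norm.
  rewrite -!EFinM lee_fin /B mulrAC -[leRHS]mulrA ler_wpM2l//.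
  rewrite -exp2D ler_exp2.
  have : N%:R * (theta / 4) <= n%:R * (theta / 4).
    by rewrite ler_wpM2r ?(ltW th4)// ler_nat.
  by move=> ?; lra.
rewrite nneseriesZl; last by move=> n _; rewrite lee_fin exp2_ge0.
apply: (@le_trans _ _ (B%:E * G%:E)%E); first by rewrite lee_wpmul2l ?lee_fin.
rewrite -EFinM lee_fin /B.
have Nk : log2 ((A * `|M| * G + 1) / b) <= N%:R * (theta / 4).
  rewrite subr0 in kP; apply: (le_trans kP).
  by rewrite ler_wpM2r ?(ltW th4)// ler_nat leq_maxr.
have AMG0 : 0 <= A * `|M| * G by rewrite mulr_ge0.
rewrite mulrAC; apply: (@le_trans _ _ ((A * `|M| * G + 1) *
    exp2 (- (N%:R * (theta / 4))))).
  by rewrite ler_wpM2r ?exp2_ge0// lerDl.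
have AMG1 : 0 < A * `|M| * G + 1 by rewrite ltr_wpDl.
by rewrite mul_exp2_le//; move: Nk; rewrite log2_div// => ?; lra.
Qed.

End Comparison.

(** * Transfer principles *)

Section Transfer.
Context {R : realType} {X : metricType R}.
Variables (T : X -> X) (u : X -> R).
Local Notation S := (birkhoff T u).
Implicit Types (w : X * nat -> \bar R) (Y Z A : set X) (c e s theta eps : R).

Definition expanding c : set X := [set x |
  [/\ exists K : R, forall n, n%:R * c - K <= S n x,
      tempered_contraction T u x & sublinear_growth T u x]].

Lemma regular_le c e (K K' : R) x : K <= K' ->
  regular T u c e K x -> regular T u c e K' x.
Proof.
move=> KK [G1 G2 G3]; split=> [n|n|n k kn].
- by have := G1 n => ?; lra.
- by apply: (le_trans (G2 n)); rewrite lerD2r.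
- by have := G3 n k kn => ?; lra.
Qed.

Lemma expanding_regular c e x : 0 < e -> expanding c x ->
  exists K : R, regular T u c e K x.
Proof.
move=> e0 [[K1 G1] tc sg].
have [K3 G3] : exists K3 : R, forall n k, (k <= n)%N ->
    - K3 - n%:R * e <= S (n - k) (iter k T x).
  have := tc e e0; set I := ereal_inf _ => I0.
  have [K KI] : exists K : R, ((- K)%:E <= I)%E.
    case: I I0 => [r| |] // _; first by exists (- r); rewrite opprK.
    by exists 0; rewrite leey.
  exists K => n k kn; rewrite lerBlDr -lee_fin; apply: (le_trans KI).
  by apply: ereal_inf_lbound; exists (n, k).
have [K2 K20 G2] : exists2 K2 : R, 0 <= K2 &
    forall n, `|u (iter n T x)| - n%:R * e <= K2.
  have /cvgr0_norm_le/(_ _ e0)[N _ NP] := sg.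
  apply: (@eventually_bounded _ _ N.+1) => n Nn.
  have := NP n (ltnW Nn) => /=.
  rewrite normrM normfV normr_nat ler_pdivrMr 1?mulrC ?subr_le0// ltr0n.
  exact: leq_ltn_trans Nn.
exists (`|K1| + K2 + `|K3|); have k1 := normr_ge0 K1; have k3 := normr_ge0 K3.
split=> [n|n|n k kn].
- by have := G1 n; have := ler_norm K1 => ? ?; lra.
- by have := G2 n => ?; lra.
- by have := G3 n k kn; have := ler_norm K3 => ? ?; lra.
Qed.

(** On the scale [2 * eps] distortion costs [e] per iterate, and [6 * s * e]
    bounds the rate of all the errors that the four comparisons accumulate; the
    scale is doubled because Bowen balls get recentered. *)
Definition comparison_scale c theta s eps : Prop := 0 < eps /\
  exists e, [/\ 0 < e, 2 * e < c, 6 * s * e <= theta &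
    distortion T u e (2 * eps)].

Lemma comparison_scale_near c theta s :
  (forall e, 0 < e -> exists2 eps : R, 0 < eps & distortion T u e eps) ->
  0 < c -> 0 < theta -> 0 <= s -> exists2 eps0 : R, 0 < eps0 &
    forall eps, 0 < eps <= eps0 -> comparison_scale c theta s eps.
Proof.
move=> Du c0 th0 s0.
pose e := Num.min (c / 4) (theta / (6 * (s + 1))).
have s60 : 0 < 6 * (s + 1) by lra.
have e0 : 0 < e by rewrite lt_min !divr_gt0.
have ec : e <= c / 4 by rewrite ge_min lexx.
have et : e * (6 * (s + 1)) <= theta by rewrite -ler_pdivlMr// ge_min lexx orbT.
have [eps0 eps00 D] := Du e e0.
exists (eps0 / 2) => [|eps /andP[p0 pe]]; first by rewrite divr_gt0.
split=> //; exists e; split=> //; first lra.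
  by have : 0 <= s * e by [rewrite mulr_ge0// ltW]; lra.
by apply: distortion_le D; lra.
Qed.

Lemma comparison_scale_le c theta s s' eps : s <= s' ->
  comparison_scale c theta s' eps -> comparison_scale c theta s eps.
Proof.
move=> ss [eps0 [e [e0 ec se D]]]; split=> //; exists e; split=> //.
by apply: le_trans se; rewrite ler_wpM2r ?(ltW e0)// ler_wpM2l.
Qed.

(** Up to subexponential factors [exp2 (- s * S n x)] is the [s]-th power of
    the radius of the Bowen ball of order [n] at [x]. The rate [theta] is the
    room that a comparison with it leaves for distortion errors. *)
Definition light s theta w Z : Prop := forall x, Z x -> exists C : R,
  forall n, (w (x, n) <= (exp2 (C - n%:R * theta - s * S n x))%:E)%E.

Definition heavy eps s theta w Z : Prop := forall x, Z x -> exists C : R,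
  forall y n, bowen_ball T n y eps x ->
    ((exp2 (- C + n%:R * theta - s * S n x))%:E <= w (y, n))%E.

Definition light_piece c e s theta w Z (k : nat) : set X :=
  [set x | [/\ Z x, regular T u c e k%:R x & forall n,
    (w (x, n) <= (exp2 (k%:R - n%:R * theta - s * S n x))%:E)%E]].

Definition heavy_piece c e eps s theta w Z (k : nat) : set X :=
  [set x | [/\ Z x, regular T u c e k%:R x & forall y n,
    bowen_ball T n y eps x ->
    ((exp2 (- k%:R + n%:R * theta - s * S n x))%:E <= w (y, n))%E]].

Lemma common_bound (K C : R) : exists k : nat, K <= k%:R /\ C <= k%:R.
Proof.
exists (Num.bound (Num.max `|K| `|C|)).
have m0 : 0 <= Num.max `|K| `|C| by rewrite le_max normr_ge0.
have := archi_boundP m0; rewrite gt_max => /andP[/ltW h1 /ltW h2].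
by split; [apply: le_trans h1|apply: le_trans h2]; exact: ler_norm.
Qed.

Lemma light_pieces c e s theta w Z : 0 < e -> Z `<=` expanding c ->
  light s theta w Z -> Z `<=` \bigcup_k light_piece c e s theta w Z k.
Proof.
move=> e0 Zc wZ x Zx; have [K GK] := expanding_regular e0 (Zc x Zx).
have [C wC] := wZ x Zx; have [k [Kk Ck]] := common_bound K C.
exists k => //; split=> [//||n]; first exact: regular_le GK.
apply: (le_trans (wC n)); rewrite lee_fin ler_exp2; lra.
Qed.

Lemma heavy_pieces c e eps s theta w Z : 0 < e -> Z `<=` expanding c ->
  heavy eps s theta w Z ->
  Z `<=` \bigcup_k heavy_piece c e eps s theta w Z k.
Proof.
move=> e0 Zc wZ x Zx; have [K GK] := expanding_regular e0 (Zc x Zx).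
have [C wC] := wZ x Zx; have [k [Kk Ck]] := common_bound K C.
exists k => //; split=> [//||y n yx]; first exact: regular_le GK.
apply: le_trans (wC y n yx); rewrite lee_fin ler_exp2; lra.
Qed.

Lemma hausdorff_null_subset s Y Z : Y `<=` Z -> hausdorff_null s Z ->
  hausdorff_null s Y.
Proof. by move=> YZ nZ d d0; apply: null_cover_subset (nZ d d0). Qed.

Lemma bowen_null_subset eps w Y Z : Y `<=` Z ->
  bowen_null T eps w Z -> bowen_null T eps w Y.
Proof. by move=> YZ nZ N; apply: null_cover_subset (nZ N). Qed.

Lemma bowen_null_bigcup eps w (B : nat -> set X) Z : (forall p, 0 <= w p)%E ->
  (forall k, bowen_null T eps w (B k)) -> Z `<=` \bigcup_k B k ->
  bowen_null T eps w Z.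
Proof.
by move=> w0 nB ZB N; apply: null_cover_bigcup ZB => // k; exact: nB.
Qed.

Lemma packing_premeasure_subset s delta Y Z : Y `<=` Z ->
  (packing_premeasure s delta Y <= packing_premeasure s delta Z)%E.
Proof.
move=> YZ; apply: ereal_sup_le => _ [F [cF FY tF] <-]; exists F => //.
by split=> // p /FY[/YZ].
Qed.

Lemma span_bounded_subset eps w Y Z : Y `<=` Z ->
  span_bounded T eps w Z -> span_bounded T eps w Y.
Proof.
move=> YZ [M [N MP]]; exists M, N => n /MP[E [cE ZE] EM]; exists E => //.
by split=> //; exact: subset_trans ZE.
Qed.

Lemma sigma_cover_restrict (Q Q' : set (set X)) Y Z : Y `<=` Z ->
  (forall A, Q A -> Q' (A `&` Y)) -> sigma_cover Q Z -> sigma_cover Q' Y.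
Proof.
move=> YZ QQ' [A ZA QA]; exists (fun i => A i `&` Y) => [x Yx|i].
  by have [i _ Ai] := ZA _ (YZ _ Yx); exists i.
exact: QQ'.
Qed.

Lemma hausdorff_bowen_null c theta s eps w Z :
  comparison_scale c theta s eps -> 0 <= s -> (forall p, 0 <= w p)%E ->
  Z `<=` expanding c -> light s theta w Z ->
  hausdorff_null s Z -> bowen_null T eps w Z.
Proof.
move=> [eps0 [e [e0 ec se D]]] s0 w0 Zc wZ nZ.
apply: bowen_null_bigcup (light_pieces e0 Zc wZ) => // k.
have se0 : 0 <= s * e by rewrite mulr_ge0// ltW.
apply: (hausdorff_bowen_null_piece (c := c) (e := e) (K := k%:R) (C := k%:R)
  (theta := theta) (s := s)) => //.
- by apply: distortion_le D; lra.
- lra.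
- lra.
- by move=> x [].
- by move=> x n [_ _].
- by apply: hausdorff_null_subset nZ => x [].
Qed.

Lemma bowen_hausdorff_null c theta s eps w Z :
  comparison_scale c theta s eps -> 0 <= s -> (forall p, 0 <= w p)%E ->
  Z `<=` expanding c -> heavy eps s theta w Z ->
  bowen_null T eps w Z -> hausdorff_null s Z.
Proof.
move=> [eps0 [e [e0 ec se D]]] s0 w0 Zc wZ nZ.
apply: hausdorff_null_bigcup (heavy_pieces e0 Zc wZ) => k.
have se0 : 0 <= s * e by rewrite mulr_ge0// ltW.
apply: (bowen_hausdorff_null_piece (c := c) (e := e) (K := k%:R) (C := k%:R)
  (theta := theta) (eps := eps) (w := w) D) => //.
- lra.
- by move=> x [].
- by move=> x y n [_ _]; exact.
- by apply: bowen_null_subset nZ => x [].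
Qed.

Lemma packing_span_bounded c theta s eps w Z : separable_space X ->
  comparison_scale c theta s eps -> 0 <= s -> (forall p, 0 <= w p)%E ->
  Z `<=` expanding c -> light s theta w Z ->
  sigma_cover (fun A => packing_limit s A < +oo)%E Z ->
  sigma_cover (span_bounded T eps w) Z.
Proof.
move=> sep [eps0 [e [e0 ec se D]]] s0 w0 Zc wZ sZ.
apply: sigma_cover_bigcup (light_pieces e0 Zc wZ) => k.
have se0 : 0 <= s * e by rewrite mulr_ge0// ltW.
apply: sigma_cover_restrict sZ => [x []//|A /packing_limit_lty[d d0 Ad]].
apply: (packing_span_bounded_piece (c := c) (e := e) (K := k%:R) (C := k%:R)
  (theta := theta) (s := s) (delta := d)) => //.
- by apply: distortion_le D; lra.
- lra.
- lra.
- by move=> x [_ []].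
- by move=> x n [_ []].
- by apply: le_lt_trans Ad; apply: packing_premeasure_subset; exact: subIsetl.
Qed.

Lemma span_bounded_packing c theta s eps w Z :
  comparison_scale c theta s eps -> 0 <= s -> 0 < theta ->
  (forall p, 0 <= w p)%E ->
  Z `<=` expanding c -> heavy eps s theta w Z ->
  sigma_cover (span_bounded T eps w) Z ->
  sigma_cover (fun A => packing_limit s A = 0%E) Z.
Proof.
move=> [eps0 [e [e0 ec se D]]] s0 th0 w0 Zc wZ sZ.
apply: sigma_cover_bigcup (heavy_pieces e0 Zc wZ) => k.
apply: sigma_cover_restrict sZ => [x []//|A sA].
apply: (span_bounded_packing_piece (c := c) (e := e) (K := k%:R) (C := k%:R)
  (theta := theta) (eps := eps) (w := w) D) => //.
- by move=> x [_ []].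
- by move=> x y n [_ [_ _]]; exact.
- by apply: span_bounded_subset sA; exact: subIsetl.
Qed.

End Transfer.

(** * Dimensions and pressures at a fixed scale *)

Section Scales.
Context {R : realType} {X : metricType R}.
Variable T : X -> X.
Implicit Types (u phi : X -> R) (w : X * nat -> \bar R) (Z A : set X).
Implicit Types (s t e eps : R).
Local Open Scope ereal_scope.

Definition pressure_weight phi t e (p : X * nat) : \bar R :=
  exp2e (- (p.2%:R * t)%:E + bowen_sup T phi p.1 p.2 e).

Definition dim_weight u s e (p : X * nat) : \bar R :=
  exp2e (- (s%:E * bowen_sup T u p.1 p.2 e)).

(** A lower bound for [dim_weight u s0 e] that is uniform in [s0] between [0]
    and [s]; it is needed because [dim_weight] increases with [s] on the balls
    where the supremum is negative. *)
Definition dim_weight_min u s e (p : X * nat) : \bar R :=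
  exp2e (- (s%:E * maxe 0 (bowen_sup T u p.1 p.2 e))).

Lemma dim_weight_min_le u s s0 e p : (0 <= s0)%R -> (s0 <= s)%R ->
  dim_weight_min u s e p <= dim_weight u s0 e p.
Proof.
move=> s00 s0s; apply: lee_exp2e; rewrite leeN2.
have m0 : 0 <= maxe 0 (bowen_sup T u p.1 p.2 e) by rewrite le_max lexx.
apply: (@le_trans _ _ (s0%:E * maxe 0 (bowen_sup T u p.1 p.2 e))).
  by rewrite lee_wpmul2l ?lee_fin// le_max lexx orbT.
by rewrite lee_wpmul2r ?lee_fin.
Qed.

Lemma bowen_sup_ge f n x y e :
  bowen_ball T n x e y -> (birkhoff T f n y)%:E <= bowen_sup T f x n e.
Proof. by move=> xy; apply: ereal_sup_ubound; exists y. Qed.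

Lemma bowen_sup_le f n x e (b : R) :
  (forall y, bowen_ball T n x e y -> (birkhoff T f n y <= b)%R) ->
  bowen_sup T f x n e <= b%:E.
Proof. by move=> h; apply: ge_ereal_sup => _ [y xy <-]; rewrite lee_fin h. Qed.

Lemma bowen_sup_scale f n x e e' : (e <= e')%R ->
  bowen_sup T f x n e <= bowen_sup T f x n e'.
Proof.
move=> ee; apply: ereal_sup_le => _ [y xy <-]; exists y => //.
exact: bowen_ball_le xy.
Qed.

Lemma bowen_null_weaken eps eps' w w' Z : (eps <= eps')%R ->
  (forall p, w' p <= w p) -> bowen_null T eps w Z -> bowen_null T eps' w' Z.
Proof.
move=> ee ww nZ N b b0; have [F [cF FN ZF Fb]] := nZ N b b0; exists F; split=> //.
  by move=> x /ZF[p Fp px]; exists p => //; exact: bowen_ball_le px.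
by apply: le_trans Fb; apply: le_esum.
Qed.

Lemma span_bounded_weaken eps eps' w w' Z : (eps <= eps')%R ->
  (forall p, w' p <= w p) ->
  span_bounded T eps w Z -> span_bounded T eps' w' Z.
Proof.
move=> ee ww [M [N MP]]; exists M, N => n /MP[E [cE ZE] EM]; exists E.
  by split=> // x /ZE[y Ey yx]; exists y => //; exact: bowen_ball_le yx.
by apply: le_trans EM; apply: le_esum.
Qed.

Lemma bowen_limit_eq0P w e Z : (forall p, 0 <= w p) ->
  limn (fun N => ereal_inf [set \esum_(p in F) w p | F in
    bowen_covers T Z N e]) = 0 <-> bowen_null T e w Z.
Proof.
move=> w0; have pos N y : [set \esum_(p in F) w p | F in
    bowen_covers T Z N e] y -> 0 <= y.
  by move=> [F _ <-]; rewrite esum_ge0.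
rewrite limn_sup; last first.
  move=> m n mn; apply: ereal_inf_le_tmp => _ [F [cF FN ZF] <-]; exists F => //.
  by split=> // p /FN; exact: leq_trans.
rewrite ereal_sup_image_eq0P; last 2 first.
- by exists 0%N.
- by move=> N _; apply: le_ereal_inf_tmp => y; exact: pos.
split=> [h N b b0|h N _].
  have /(ereal_inf_eq0P (@pos N))/(_ _ b0) := h N I.
  by move=> [_ [F [cF FN ZF] <-] Fb]; exists F.
apply/(ereal_inf_eq0P (@pos N)) => b b0; have [F [cF FN ZF Fb]] := h N _ b0.
by exists (\esum_(p in F) w p) => //; exists F.
Qed.

Lemma m_P_eq0P Z t phi e :
  m_P T Z t phi e = 0 <-> bowen_null T e (pressure_weight phi t e) Z.
Proof. by apply: bowen_limit_eq0P => p; exact: exp2e_ge0. Qed.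

Lemma m_BS_eq0P Z s u e :
  m_BS T Z s u e = 0 <-> bowen_null T e (dim_weight u s e) Z.
Proof. by apply: bowen_limit_eq0P => p; exact: exp2e_ge0. Qed.

Definition dim_BS_at Z u e : \bar R := ereal_inf [set s%:E | s in
  [set s : R | (0 <= s)%R /\ m_BS T Z s u e = 0]].

Definition Dim_BS_at Z u e : \bar R := ereal_inf [set
    ereal_sup [set dim_BSC T (A i) u e | i in [set: nat]]
  | A in [set A : nat -> set X | Z `<=` \bigcup_i A i]].

Definition lower_pressure_at Z phi e : \bar R :=
  ereal_inf [set s%:E | s in [set s : R | m_P T Z s phi e = 0]].

Definition upper_pressure_at Z phi e : \bar R := ereal_inf [set
    ereal_sup [set P_UC T (A i) phi e | i in [set: nat]]
  | A in [set A : nat -> set X | Z `<=` \bigcup_i A i]].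

Lemma dim_weight_scale u s e e' p : (0 <= s)%R -> (e <= e')%R ->
  dim_weight u s e' p <= dim_weight u s e p.
Proof.
move=> s0 ee; apply: lee_exp2e; rewrite leeN2 lee_wpmul2l ?lee_fin//.
exact: bowen_sup_scale.
Qed.

Lemma dim_BS_at_mono Z u e e' : (e <= e')%R ->
  dim_BS_at Z u e' <= dim_BS_at Z u e.
Proof.
move=> ee; apply: ereal_inf_le_tmp => _ [s [s0 /m_BS_eq0P sZ] <-].
exists s => //; split=> //; apply/m_BS_eq0P.
apply: (bowen_null_weaken ee _ sZ) => p.
exact: dim_weight_scale.
Qed.

Lemma dim_BS_at_lt Z u e s : dim_BS_at Z u e < s%:E ->
  bowen_null T e (dim_weight_min u s e) Z.
Proof.
move=> /ereal_inf_lt[_ [s0 [s00 /m_BS_eq0P s0Z] <-] s0s].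
apply: (bowen_null_weaken (lexx e) _ s0Z) => p.
by apply: dim_weight_min_le => //; exact: ltW.
Qed.

Lemma dim_BS_at_le Z u e s : (0 <= s)%R ->
  bowen_null T e (dim_weight u s e) Z -> dim_BS_at Z u e <= s%:E.
Proof.
move=> s0 sZ; apply: ereal_inf_lbound; exists s => //.
by split=> //; apply/m_BS_eq0P.
Qed.

Lemma dim_BS_at_ge0 Z u e : 0 <= dim_BS_at Z u e.
Proof. by apply: le_ereal_inf_tmp => _ [s [s0 _] <-]. Qed.

Lemma limn_esup_span_bounded w e Z :
  limn_esup (fun n => ereal_inf [set \esum_(x in E) w (x, n)
    | E in spanning_sets T Z n e]) < +oo <-> span_bounded T e w Z.
Proof.
split=> [/limn_esup_lt_fin[M [N MP]]|[M [N MP]]]; last first.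
  apply: (@le_lt_trans _ _ M%:E); last exact: ltry.
  apply: (@limn_esup_le _ _ _ N) => n /MP[E sE EM]; apply: le_trans EM.
  by apply: ereal_inf_lbound; exists E.
exists M, N => n /MP /ereal_inf_lt[_ [E sE <-] EM]; exists E => //.
exact: ltW.
Qed.

Lemma Dim_BS_at_mono Z u e e' : (e <= e')%R ->
  Dim_BS_at Z u e' <= Dim_BS_at Z u e.
Proof.
move=> ee; apply: le_ereal_inf_tmp => _ [A ZA <-].
apply: (@le_trans _ _ (ereal_sup [set dim_BSC T (A i) u e' | i in [set: nat]])).
  by apply: ereal_inf_lbound; exists A.
apply: ge_ereal_sup => _ [i _ <-].
apply: (@le_trans _ _ (dim_BSC T (A i) u e)); last first.
  by apply: ereal_sup_ubound; exists i.
apply: ereal_inf_le_tmp => _ [s [s0 sA] <-].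
move: sA => /(limn_esup_span_bounded (dim_weight u s e)) sA.
exists s => //; split=> //; apply/(limn_esup_span_bounded (dim_weight u s e')).
by apply: (span_bounded_weaken ee _ sA) => p; exact: dim_weight_scale.
Qed.

Lemma Dim_BS_at_lt Z u e s : Dim_BS_at Z u e < s%:E ->
  sigma_cover (span_bounded T e (dim_weight_min u s e)) Z.
Proof.
move=> /ereal_inf_lt[_ [A ZA <-] As]; exists A => // i.
have : dim_BSC T (A i) u e < s%:E.
  by apply: le_lt_trans As; apply: ereal_sup_ubound; exists i.
move=> /ereal_inf_lt[_ [s0 [s00 h] <-] s0s].
move: h => /(limn_esup_span_bounded (dim_weight u s0 e)) s0A.
apply: (span_bounded_weaken (lexx e) _ s0A) => p.
by apply: dim_weight_min_le => //; exact: ltW.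
Qed.

Lemma Dim_BS_at_le Z u e s : (0 <= s)%R ->
  sigma_cover (span_bounded T e (dim_weight u s e)) Z ->
  Dim_BS_at Z u e <= s%:E.
Proof.
move=> s0 [A ZA sA].
apply: (@le_trans _ _ (ereal_sup [set dim_BSC T (A i) u e | i in [set: nat]])).
  by apply: ereal_inf_lbound; exists A.
apply: ge_ereal_sup => _ [i _ <-]; apply: ereal_inf_lbound; exists s => //.
by split=> //; apply/(limn_esup_span_bounded (dim_weight u s e)).
Qed.

Lemma Dim_BS_at_ge0 Z u e : 0 <= Dim_BS_at Z u e.
Proof.
apply: le_ereal_inf_tmp => _ [A _ <-]; apply: le_ereal_sup_tmp.
exists (dim_BSC T (A 0%N) u e); first by exists 0%N.
by apply: le_ereal_inf_tmp => _ [s [s0 _] <-].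
Qed.

Lemma lower_pressure_at_lt Z phi e t : lower_pressure_at Z phi e < t%:E ->
  exists2 t0 : R, (t0 <= t)%R & bowen_null T e (pressure_weight phi t0 e) Z.
Proof.
move=> /ereal_inf_lt[_ [t0 /m_P_eq0P t0Z <-] t0t].
by exists t0 => //; exact: ltW.
Qed.

Lemma lower_pressure_at_le Z phi e t :
  bowen_null T e (pressure_weight phi t e) Z ->
  lower_pressure_at Z phi e <= t%:E.
Proof. by move=> /m_P_eq0P tZ; apply: ereal_inf_lbound; exists t. Qed.

Lemma pressure_weightE phi t e x n : pressure_weight phi t e (x, n) =
  (exp2 (- (n%:R * t)))%:E * exp2e (bowen_sup T phi x n e).
Proof. by rewrite /pressure_weight -EFinN exp2eD. Qed.

Lemma upper_pressure_at_lt Z phi e t : upper_pressure_at Z phi e < t%:E ->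
  sigma_cover (span_bounded T e (pressure_weight phi t e)) Z.
Proof.
move=> /ereal_inf_lt[_ [A ZA <-] At]; exists A => // i.
have : P_UC T (A i) phi e < t%:E.
  by apply: le_lt_trans At; apply: ereal_sup_ubound; exists i.
move=> /limn_esup_lt[N NP]; exists 1%R, N.+1 => n Nn.
have n0 : (0 < n%:R :> R)%R by rewrite ltr0n (leq_ltn_trans _ Nn).
have := NP n (ltnW Nn).
rewrite -(@lte_pmul2l _ n%:R%:E) ?lte_fin// muleA -EFinM divff ?gt_eqF//.
rewrite mul1e -EFinM => /log2e_lt/ereal_inf_lt[_ [E sE <-] Et]; exists E => //.
under eq_esum do rewrite pressure_weightE.
apply: (le_trans (esumZ_le _ (exp2_ge0 _) _)); first by move=> x; exact: exp2e_ge0.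
apply: (@le_trans _ _ ((exp2 (- (n%:R * t)))%:E * (exp2 (n%:R * t))%:E)).
  by rewrite lee_wpmul2l ?lee_fin ?exp2_ge0// ltW.
by rewrite -EFinM -exp2D addNr exp2_0.
Qed.

Lemma upper_pressure_at_le Z phi e t t' : (t < t')%R ->
  sigma_cover (span_bounded T e (pressure_weight phi t e)) Z ->
  upper_pressure_at Z phi e <= t'%:E.
Proof.
move=> tt [A ZA tA].
apply: (@le_trans _ _ (ereal_sup [set P_UC T (A i) phi e | i in [set: nat]])).
  by apply: ereal_inf_lbound; exists A.
apply: ge_ereal_sup => _ [i _ <-]; have [M [N MP]] := tA i.
have tt0 : (0 < t' - t)%R by rewrite subr_gt0.
have [k kP] := linear_unbounded 0 (log2 (`|M| + 1)) tt0.
apply: (@limn_esup_le _ _ _ (maxn N k).+1) => n nNk.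
have /MP[E sE EM] : (N <= n)%N by apply: leq_trans (ltnW nNk); rewrite leq_maxl.
have n0 : (0 < n%:R :> R)%R by rewrite ltr0n (leq_ltn_trans _ nNk).
rewrite -(@lee_pmul2l _ n%:R%:E) ?lte_fin// muleA -EFinM divff ?gt_eqF//.
rewrite mul1e -EFinM; apply: log2e_le.
apply: (@le_trans _ _ (\esum_(x in E) exp2e (bowen_sup T phi x n e))).
  by apply: ereal_inf_lbound; exists E.
have -> : \esum_(x in E) exp2e (bowen_sup T phi x n e) =
    \esum_(x in E) ((exp2 (n%:R * t))%:E * pressure_weight phi t e (x, n)).
  apply: eq_esum => x _; rewrite pressure_weightE muleA -EFinM -exp2D subrr.
  by rewrite exp2_0 mul1e.
apply: (le_trans (esumZ_le _ (exp2_ge0 _) _)); first by move=> x; exact: exp2e_ge0.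
apply: (@le_trans _ _ ((exp2 (n%:R * t))%:E * M%:E)).
  by rewrite lee_wpmul2l ?lee_fin ?exp2_ge0.
rewrite -EFinM lee_fin.
apply: (@le_trans _ _ (exp2 (n%:R * t) * exp2 (n%:R * (t' - t))))%R; last first.
  by rewrite -exp2D ler_exp2; lra.
rewrite ler_wpM2l ?exp2_ge0//; apply: (@le_trans _ _ (`|M| + 1))%R.
  by rewrite (le_trans (ler_norm _))// lerDl.
have M0 : (0 < `|M| + 1)%R by rewrite ltr_wpDl.
rewrite -(log2K M0) ler_exp2; move: kP; rewrite subr0 => /le_trans; apply.
rewrite ler_wpM2r ?(ltW tt0)// ler_nat; apply: leq_trans (ltnW nNk).
exact: leq_maxr.
Qed.

End Scales.

(** * The two dimension theories *)

Section Averages.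
Context {R : realType} {X : metricType R}.
Variables (T : X -> X) (u : X -> R).
Local Notation S := (birkhoff T u).

Lemma lower_avg_gt (c : R) x : (c%:E < lower_avg T u x)%E ->
  exists K : R, forall n, n%:R * c - K <= S n x.
Proof.
move=> /limn_einf_gt[N NP].
have [|K _ KP] := @eventually_bounded R (fun n => n%:R * c - S n x) N.+1.
  move=> n Nn; have := NP n (ltnW Nn).
  have n0 : 0 < n%:R :> R by rewrite ltr0n (leq_ltn_trans _ Nn).
  by rewrite lte_fin ltr_pdivlMr// mulrC subr_le0 => /ltW.
by exists K => n; have := KP n => ?; lra.
Qed.

Lemma upper_avg_lt (c : R) x : (upper_avg T u x < c%:E)%E ->
  exists K : R, forall n, S n x <= n%:R * c + K.
Proof.
move=> /limn_esup_lt[N NP].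
have [|K _ KP] := @eventually_bounded R (fun n => S n x - n%:R * c) N.+1.
  move=> n Nn; have := NP n (ltnW Nn).
  have n0 : 0 < n%:R :> R by rewrite ltr0n (leq_ltn_trans _ Nn).
  by rewrite lte_fin ltr_pdivrMr// mulrC subr_le0 => /ltW.
by exists K => n; have := KP n => ?; lra.
Qed.

End Averages.

(** What the Hausdorff and the packing case have in common, so that the main
    arguments are given once. [bounded s] is what an exponent [s] above the
    dimension provides, [vanishing s] is what shows that the dimension is at
    most [s]; for packings the two differ, since finite packing sums are what
    produces spanning sets, while the converse comparison yields sums that tend
    to zero. [negligible eps w] is smallness on the dynamical side, for Bowen
    balls of scale [eps] weighted by [w]. *)
Record dimension_comparison {R : realType} {X : metricType R} (T : X -> X)
    (u : X -> R) (negligible : R -> (X * nat -> \bar R) -> set X -> Prop)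
    (bounded vanishing : R -> set X -> Prop) (dim : set X -> \bar R) : Prop := {
  negligible_subset : forall eps w Y Z, Y `<=` Z ->
    negligible eps w Z -> negligible eps w Y;
  negligible_bigcup : forall eps w (B : nat -> set X) Z,
    (forall p, 0 <= w p)%E -> (forall k, negligible eps w (B k)) ->
    Z `<=` \bigcup_k B k -> negligible eps w Z;
  negligible_weaken : forall eps eps' w w' Z, eps <= eps' ->
    (forall p, w' p <= w p)%E -> negligible eps w Z -> negligible eps' w' Z;
  negligible0 : forall eps w, negligible eps w set0;
  bounded_subset : forall s Y Z, Y `<=` Z -> bounded s Z -> bounded s Y;
  vanishing_bigcup : forall s (B : nat -> set X) Z,
    (forall k, vanishing s (B k)) -> Z `<=` \bigcup_k B k -> vanishing s Z;
  vanishing0 : forall Z, vanishing 0 Z -> Z = set0;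
  dim_lt_bounded : forall s Z, (dim Z < s%:E)%E ->
    exists s0 : R, [/\ 0 <= s0, s0 < s & bounded s0 Z];
  dim_le_vanishing : forall s Z, 0 <= s -> vanishing s Z -> (dim Z <= s%:E)%E;
  bounded_negligible : forall c theta s eps w Z,
    comparison_scale T u c theta s eps -> 0 <= s -> (forall p, 0 <= w p)%E ->
    Z `<=` expanding T u c -> light T u s theta w Z -> bounded s Z ->
    negligible eps w Z;
  negligible_vanishing : forall c theta s eps w Z,
    comparison_scale T u c theta s eps -> 0 <= s -> 0 < theta ->
    (forall p, 0 <= w p)%E -> Z `<=` expanding T u c ->
    heavy T u eps s theta w Z -> negligible eps w Z -> vanishing s Z }.

Section Instances.
Context {R : realType} {X : metricType R}.
Variables (T : X -> X) (u : X -> R).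

Lemma hausdorff_comparison : dimension_comparison T u (bowen_null T)
  hausdorff_null hausdorff_null (@dim_H R X).
Proof.
split.
- by move=> eps w Y Z; exact: bowen_null_subset.
- by move=> eps w B Z; exact: bowen_null_bigcup.
- by move=> eps eps' w w' Z; exact: bowen_null_weaken.
- move=> eps w N b b0; exists set0.
  split; [exact: countable0|exact: sub0set|exact: sub0set|].
  by rewrite esum_set0 lee_fin ltW.
- by move=> s Y Z; exact: hausdorff_null_subset.
- by move=> s B Z; exact: hausdorff_null_bigcup.
- exact: hausdorff_null0.
- exact: dim_H_lt.
- exact: dim_H_le.
- exact: hausdorff_bowen_null.
- by move=> c theta s eps w Z cs s0 _; exact: bowen_hausdorff_null cs s0.
Qed.

Lemma packing_comparison : separable_space X ->
  dimension_comparison T u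
    (fun eps w => sigma_cover (span_bounded T eps w))
    (fun s => sigma_cover (fun A => packing_limit s A < +oo)%E)
    (fun s => sigma_cover (fun A => packing_limit s A = 0%E))
    (@dim_P R X).
Proof.
move=> sep; split.
- by move=> eps w Y Z YZ; apply: sigma_cover_sub YZ.
- by move=> eps w B Z _; exact: sigma_cover_bigcup.
- by move=> eps eps' w w' Z ee ww; apply: sigma_cover_sub => // A;
    exact: span_bounded_weaken.
- move=> eps w; exists (fun=> set0) => // _; exists 0, 0%N => n _; exists set0.
    by split; [exact: countable0|exact: sub0set].
  by rewrite esum_set0.
- by move=> s Y Z YZ; apply: sigma_cover_sub YZ.
- by move=> s B Z; exact: sigma_cover_bigcup.
- move=> Z [A ZA A0]; apply/seteqP; split=> // x /ZA[i _].
  by rewrite (packing_limit0 (A0 i)).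
- exact: dim_P_lt.
- exact: dim_P_le.
- by move=> c theta s eps w Z; exact: packing_span_bounded.
- by move=> c theta s eps w Z; exact: span_bounded_packing.
Qed.

End Instances.

Section Weights.
Context {R : realType} {X : metricType R}.
Variables (T : X -> X) (u : X -> R).
Local Notation S := (birkhoff T u).
Implicit Types (Z : set X) (c theta s t eps : R).

Lemma pressure_weight_ge phi t e n y x : bowen_ball T n y e x ->
  ((exp2 (- (n%:R * t) + birkhoff T phi n x))%:E <=
    pressure_weight T phi t e (y, n))%E.
Proof.
move=> yx; rewrite -exp2e_EFin EFinD; apply: lee_exp2e.
by rewrite leeD2l//; exact: bowen_sup_ge.
Qed.

Lemma pressure_weight_le phi t e n x (b : R) :
  (forall y, bowen_ball T n x e y -> birkhoff T phi n y <= b) ->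
  (pressure_weight T phi t e (x, n) <= (exp2 (- (n%:R * t) + b))%:E)%E.
Proof.
move=> xb; rewrite -exp2e_EFin EFinD; apply: lee_exp2e.
by rewrite leeD2l//; exact: bowen_sup_le.
Qed.

Lemma scale_expanding x : (0%:E < lower_avg T u x)%E ->
  exists j : nat, exists K : R, forall n, n%:R * j.+1%:R^-1 - K <= S n x.
Proof.
move=> l0; have [d d0 dl] : exists2 d : R, 0 < d & (d%:E < lower_avg T u x)%E.
  case: (lower_avg T u x) l0 => [r| |] // r0.
    exists (r / 2); rewrite ?divr_gt0// lte_fin ltr_pdivrMr//.
    by rewrite mulr_natr mulr2n ltrDl.
  by exists 1; rewrite ?ltry.
have [K KP] := lower_avg_gt dl.
exists (Num.bound d^-1); exists K => n; apply: le_trans (KP n).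
rewrite lerD2r ler_wpM2l// -[leRHS]invrK lef_pV2 ?posrE ?invr_gt0//.
have d'0 : 0 <= d^-1 by rewrite invr_ge0 ltW.
by apply: (le_trans (ltW (archi_boundP d'0))); rewrite ler_nat.
Qed.

(** Raising the exponent from [s0] to [s] gains the factor [exp2 (- (s - s0) *
    S n x)], which decays exponentially where [S n x] grows linearly. *)
Lemma light_dim_weight c s0 s eps Z : 0 < eps -> 0 < c -> 0 <= s0 -> s0 < s ->
  Z `<=` expanding T u c ->
  light T u s0 ((s - s0) * c) (dim_weight T u s eps) Z.
Proof.
move=> eps0 c0 s00 s0s Zc x Zx; have [[K KP] _ _] := Zc x Zx.
exists ((s - s0) * K) => n.
have s_ge0 : 0 <= s by lra.
apply: (@le_trans _ _ (exp2e (- (s * S n x)%:E))).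
  apply: lee_exp2e; rewrite leeN2 EFinM lee_wpmul2l ?lee_fin//.
  by apply: bowen_sup_ge; exact: bowen_ball_self.
rewrite -?EFinN exp2e_EFin lee_fin ler_exp2.
have ss : 0 <= s - s0 by lra.
have := ler_wpM2l ss (KP n) => ?; lra.
Qed.

Lemma heavy_dim_weight c s s' eps Z : 0 <= s -> s < s' -> 0 < c ->
  comparison_scale T u c ((s' - s) * c / 2) s' eps -> Z `<=` expanding T u c ->
  heavy T u eps s' ((s' - s) * c / 2) (dim_weight_min T u s eps) Z.
Proof.
move=> s0 ss c0 [eps0 [e [e0 _ se D]]] Zc x Zx; have [[K KP] _ _] := Zc x Zx.
exists (s' * `|K|) => y n yx.
have nc : 0 <= n%:R * e by rewrite mulr_ge0// ltW.
have SK : - `|K| <= S n x.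
  have := KP n; have := ler_norm K; have : 0 <= n%:R * c by rewrite mulr_ge0// ltW.
  by move=> ? ? ?; lra.
have supB : (maxe 0 (bowen_sup T u y n eps) <= (S n x + n%:R * e + `|K|)%:E)%E.
  rewrite ge_max; apply/andP; split; first by rewrite lee_fin; lra.
  apply: bowen_sup_le => z yz.
  have xz := bowen_ball_triangle (bowen_ball_sym yx) yz.
  have := birkhoff_close (fun x' y' h => let: And3 _ _ h3 := D x' y' h in h3) xz.
  by rewrite ler_norml => /andP[? _]; have := normr_ge0 K => ?; lra.
apply: (@le_trans _ _ (exp2e (- (s * (S n x + n%:R * e + `|K|))%:E))); last first.
  by apply: lee_exp2e; rewrite leeN2 EFinM lee_wpmul2l ?lee_fin.
rewrite -?EFinN exp2e_EFin lee_fin ler_exp2.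
have ss' : 0 <= s' - s by lra.
have h1 := ler_wpM2l ss' (KP n).
have h2 : (s' - s) * K <= (s' - s) * `|K| by rewrite ler_wpM2l// ler_norm.
have h3 : n%:R * (6 * s' * e) <= n%:R * ((s' - s) * c / 2) by rewrite ler_wpM2l.
have h4 : s * (n%:R * e) <= s' * (n%:R * e) by rewrite ler_wpM2r// ltW.
have h5 : 0 <= s' * (n%:R * e) by rewrite mulr_ge0//; lra.
lra.
Qed.

Local Notation phi s := (fun x => - s * u x).

Lemma light_pressure_weight c theta s s0 t eps Z :
  comparison_scale T u c theta (`|s| + s0) eps -> 0 <= s0 ->
  (forall x, Z x -> exists C : R, forall n,
     (s0 - s) * S n x <= n%:R * (t - 2 * theta) + C) ->
  light T u s0 theta (pressure_weight T (phi s) t eps) Z.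
Proof.
move=> [eps0 [e [e0 _ se D]]] s00 ZC x Zx; have [C CP] := ZC x Zx.
exists C => n.
apply: (le_trans (pressure_weight_le (b := - s * S n x + `|s| * (n%:R * e)) _ _)).
  move=> y xy; rewrite birkhoffZ.
  have xy2 : bowen_ball T n x (2 * eps) y by apply: bowen_ball_le xy; lra.
  have := birkhoff_close (fun x' y' h => let: And3 _ _ h3 := D x' y' h in h3) xy2.
  move/(ler_wpM2l (normr_ge0 s)); rewrite -normrM ler_norml => /andP[_ ?]; lra.
rewrite lee_fin ler_exp2; have := CP n.
have : n%:R * (6 * (`|s| + s0) * e) <= n%:R * theta by rewrite ler_wpM2l.
have : 0 <= `|s| * (n%:R * e) by rewrite !mulr_ge0// ltW.
have : 0 <= s0 * (n%:R * e) by rewrite !mulr_ge0// ltW.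
by move=> ? ? ? ?; lra.
Qed.

Lemma heavy_pressure_weight theta s s' t eps Z :
  (forall x, Z x -> exists C : R, forall n,
     (s - s') * S n x + n%:R * (t + theta) <= C) ->
  heavy T u eps s' theta (pressure_weight T (phi s) t eps) Z.
Proof.
move=> ZC x Zx; have [C CP] := ZC x Zx; exists C => y n yx.
apply: le_trans (pressure_weight_ge _ _ yx); rewrite lee_fin ler_exp2 birkhoffZ.
by have := CP n => ?; lra.
Qed.

(** On a larger Bowen ball the supremum of the potential grows by at most [n]
    times its oscillation, which an increase of [t] compensates. *)
Lemma pressure_weight_quasimonotone s eta : 0 < eta ->
  (forall e, 0 < e -> exists2 eps : R, 0 < eps & distortion T u e eps) ->
  exists2 d : R, 0 < d & forall x y t p, 0 < x -> x <= y -> y < d ->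
    (pressure_weight T (phi s) (t + eta) y p <=
     pressure_weight T (phi s) t x p)%E.
Proof.
move=> eta0 Du; have s1 : 0 < `|s| + 1 by rewrite ltr_wpDl.
have [d d0 D] := Du _ (divr_gt0 eta0 s1).
exists d => // x y t [z n] x0 xy yd; rewrite /pressure_weight /=.
apply: lee_exp2e; apply: (@le_trans _ _ ((- (n%:R * t))%:E +
    (birkhoff T (phi s) n z)%:E)%E); last first.
  by rewrite leeD2l//; apply: bowen_sup_ge; exact: bowen_ball_self.
have -> : (- (n%:R * (t + eta)))%:E = ((- (n%:R * t))%:E - (n%:R * eta)%:E)%E.
  by rewrite -EFinN -EFinD; congr EFin; lra.
rewrite -addeA leeD2l// addeC leeBlDr// -EFinD.
apply: bowen_sup_le => z' zz'.
have zd : bowen_ball T n z d z' by apply: bowen_ball_le zz'; exact: ltW.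
have := birkhoff_close (fun x' y' h => let: And3 _ _ h3 := D x' y' h in h3) zd.
move/(ler_wpM2l (normr_ge0 s)); rewrite -normrM ler_norml => /andP[_].
have : `|s| * (n%:R * (eta / (`|s| + 1))) <= n%:R * eta.
  rewrite mulrCA ler_wpM2l// mulrCA ger_pMr// ler_pdivrMr// mul1r lerDl//.
by rewrite !birkhoffZ => ? ?; lra.
Qed.

End Weights.

(** * Bowen equations *)

Section Bowen.
Context {R : realType} {X : metricType R}.
Variables (T : X -> X) (u : X -> R).
Variables (negligible : R -> (X * nat -> \bar R) -> set X -> Prop).
Variables (bounded vanishing : R -> set X -> Prop) (dim : set X -> \bar R).
Context (DC : dimension_comparison T u negligible bounded vanishing dim).
Context (Du : forall e, 0 < e ->
  exists2 eps : R, 0 < eps & distortion T u e eps).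
Local Notation S := (birkhoff T u).

Lemma lim_at0_lt (f : R -> \bar R) (t : R) : cvg (f x @[x --> (0 : R)^'+]) ->
  (lim (f x @[x --> (0 : R)^'+]) < t%:E)%E ->
  exists2 d : R, 0 < d & forall x, 0 < x < d -> (f x < t%:E)%E.
Proof.
move=> cf ft; apply/near_at0P.
apply: (cf [set y | (y < t%:E)%E]); apply: open_nbhs_nbhs; split => //.
exact: open_ereal_lt_ereal.
Qed.

Lemma lim_at0_le (f : R -> \bar R) (l : \bar R) (d : R) :
  cvg (f x @[x --> (0 : R)^'+]) -> 0 < d ->
  (forall x, 0 < x < d -> (f x <= l)%E) ->
  (lim (f x @[x --> (0 : R)^'+]) <= l)%E.
Proof.
by move=> cf d0 fl; apply: lime_le => //; apply/near_at0P; exists d.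
Qed.

(** The exponents of points of [Z] are positive but not bounded away from zero,
    and the admissible scale depends on the lower bound. So [Z] is cut into the
    sets where the lower bound is [1 / (j + 1)]; on each of them an increase of
    the exponent [s] gains a factor exponentially small in [n], which absorbs
    all subexponential errors. *)
Lemma dim_eq_scale_limit (D : R -> \bar R) (Z : set X) :
  (forall e e', e <= e' -> (D e' <= D e)%E) -> (forall e, (0 <= D e)%E) ->
  (forall e s, (D e < s%:E)%E -> negligible e (dim_weight_min T u s e) Z) ->
  (forall e s, 0 <= s -> negligible e (dim_weight T u s e) Z ->
    (D e <= s%:E)%E) ->
  (forall x, Z x -> [/\ (0%:E < lower_avg T u x)%E,
     tempered_contraction T u x & sublinear_growth T u x]) ->
  dim Z = lim (D e @[e --> (0 : R)^'+]).
Proof.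
move=> Dmono D0 Dlt Dle ZP.
rewrite lim_at0_sup; last by move=> x y _; exact: Dmono.
set L := ereal_sup _.
have DL e : 0 < e -> (D e <= L)%E.
  by move=> e0; apply: ereal_sup_ubound; exists e.
pose Zj j := Z `&` expanding T u j.+1%:R^-1.
have ZZj : Z `<=` \bigcup_j Zj j.
  move=> x Zx; have [l0 tc sg] := ZP x Zx.
  have [j [K KP]] := scale_expanding l0; exists j => //; split=> //.
  by split=> //; exists K.
have c0 j : 0 < j.+1%:R^-1 :> R by rewrite invr_gt0 ltr0n.
apply/eqP; rewrite eq_le; apply/andP; split; apply: lee_EFin_above => s' s'P.
  have [s Ls ss] : exists2 s : R, (L < s%:E)%E & s < s'.
    have := le_trans (D0 1) (DL 1 ltr01).
    case: (L) s'P => [l| |]//; rewrite lte_fin => ls' _.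
    by exists ((l + s') / 2); rewrite ?lte_fin; lra.
  have s0 : 0 < s.
    by rewrite -lte_fin; apply: le_lt_trans Ls; exact: le_trans (D0 1) (DL 1 ltr01).
  apply: (dim_le_vanishing DC); first lra.
  apply: (vanishing_bigcup DC) ZZj => j; pose c : R := j.+1%:R^-1.
  have th0 : 0 < (s' - s) * c / 2 by rewrite divr_gt0// mulr_gt0 ?subr_gt0// c0.
  have [|eps0 eps00 csP] := comparison_scale_near Du (c0 j) th0 (s := s').
    lra.
  have cs := csP eps0; rewrite eps00 lexx in cs; have {}cs := cs isT.
  apply: (negligible_vanishing DC cs (w := dim_weight_min T u s eps0)) => //.
  - lra.
  - by move=> p; exact: exp2e_ge0.
  - by move=> x [].
  - by apply: heavy_dim_weight => //; [lra|exact: c0|move=> x []].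
  - apply: (negligible_subset DC (@subIsetl _ _ _)); apply: Dlt.
    by apply: le_lt_trans Ls; exact: DL.
have [s0 [s00 s0s Zs0]] := dim_lt_bounded DC s'P.
apply: ge_ereal_sup => _ [e e0 <-]; apply: Dle; first lra.
apply: (negligible_bigcup DC) ZZj => [p|j]; first exact: exp2e_ge0.
pose c : R := j.+1%:R^-1.
have th0 : 0 < (s' - s0) * c by rewrite mulr_gt0 ?subr_gt0// c0.
have [eps0 eps00 csP] := comparison_scale_near Du (c0 j) th0 s00.
pose eps := Num.min e eps0.
have epse : eps <= e by rewrite ge_min lexx.
have eps_gt0 : 0 < eps by rewrite lt_min e0.
have cs : comparison_scale T u c ((s' - s0) * c) s0 eps.
  by apply: csP; rewrite eps_gt0 ge_min lexx orbT.
have s'0 : 0 <= s' by lra.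
apply: (negligible_weaken DC epse (w := dim_weight T u s' eps)) => [p|].
  exact: dim_weight_scale.
apply: (bounded_negligible DC cs) => //.
- by move=> p; exact: exp2e_ge0.
- by move=> x [].
- by apply: light_dim_weight => //; [exact: c0|move=> x []].
- exact: (bounded_subset DC (@subIsetl _ _ _) Zs0).
Qed.

Section Equation.
Variables (Z : set X) (c s : R) (P : R -> \bar R).
Context (c0 : 0 < c) (Zc : Z `<=` expanding T u c).
Local Notation phi := (fun x => - s * u x).
Context (Plt : forall e t, (P e < t%:E)%E ->
  exists2 t0 : R, t0 <= t & negligible e (pressure_weight T phi t0 e) Z).
Context (Ple : forall e t t', t < t' ->
  negligible e (pressure_weight T phi t e) Z -> (P e <= t'%:E)%E).
Local Notation limP := (lim (P e @[e --> (0 : R)^'+])).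

Lemma is_cvg_pressure : cvg (P e @[e --> (0 : R)^'+]).
Proof.
apply: lim_at0_quasimonotone => eta eta0; have eta2 : 0 < eta / 2 by rewrite divr_gt0.
have [d d0 dP] := pressure_weight_quasimonotone s eta2 Du.
exists d => // x y x0 xy yd; rewrite -leeBlDr//.
apply: lee_EFin_above => t /Plt[t0 t0t nt0]; rewrite leeBlDr//.
apply: (@le_trans _ _ (t0 + eta)%:E); last by rewrite lee_fin lerD2r.
apply: (Ple (t := t0 + eta / 2)); first lra.
by apply: (negligible_weaken DC xy) nt0 => p; exact: dP.
Qed.

(** The growth condition says that [exp2 (- n * t - s * S n x)] is smaller, by
    an exponential factor, than the [s0]-th power of the radius of the Bowen
    ball. *)
Lemma pressure_le (s0 t theta : R) : 0 <= s0 -> 0 < theta -> bounded s0 Z ->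
  (forall x, Z x -> exists C : R, forall n,
     (s0 - s) * S n x <= n%:R * (t - 2 * theta) + C) ->
  (limP <= (t + theta)%:E)%E.
Proof.
move=> s00 th0 bZ ZC.
have s10 : 0 <= `|s| + s0 by rewrite addr_ge0.
have [d d0 csP] := comparison_scale_near Du c0 th0 s10.
apply: (lim_at0_le is_cvg_pressure d0) => e /andP[e0 ed].
have {csP}cs : comparison_scale T u c theta (`|s| + s0) e.
  by apply: csP; rewrite e0 ltW.
apply: (Ple (t := t)); first lra.
apply: (bounded_negligible DC (comparison_scale_le _ cs)) bZ => //.
- by rewrite lerDr.
- by move=> p; exact: exp2e_ge0.
- exact: light_pressure_weight cs _ _.
Qed.

Lemma pressure_lt_vanishing (s' t theta : R) : 0 <= s' -> 0 < theta ->
  (forall x, Z x -> exists C : R, forall n,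
     (s - s') * S n x + n%:R * (t + theta) <= C) ->
  (limP < t%:E)%E -> vanishing s' Z.
Proof.
move=> s'0 th0 ZC /(lim_at0_lt is_cvg_pressure)[d d0 dP].
have [d' d'0 csP] := comparison_scale_near Du c0 th0 s'0.
pose e := Num.min (d / 2) d'.
have e0 : 0 < e by rewrite lt_min divr_gt0.
have ed : e < d by rewrite gt_min ltr_pdivrMr// mulr_natr mulr2n ltrDl d0.
have cs : comparison_scale T u c theta s' e.
  by apply: csP; rewrite e0 ge_min lexx orbT.
have [|t0 t0t nt0] := Plt (dP e _); first by rewrite e0.
apply: (negligible_vanishing DC cs _ th0 _ Zc _ nt0) => //.
  by move=> p; exact: exp2e_ge0.
apply: heavy_pressure_weight => x /ZC[C CP]; exists C => n.
apply: le_trans (CP n); rewrite lerD2l ler_wpM2l//; lra.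
Qed.

Lemma pressure_set0 : Z = set0 -> (limP <= (-1)%:E)%E.
Proof.
move=> Z0; apply: (lim_at0_le is_cvg_pressure ltr01) => e _.
by apply: (Ple (t := -2)); [lra|rewrite Z0; exact: (negligible0 DC)].
Qed.

(** The pressure of [- s * u] decreases in [s] at a rate of at least [c]. So,
    if it is zero at [s], then [Z] is vanishing for all exponents above [s],
    and bounded for none below [s]. *)
Lemma bowen_equation_unique : limP = 0%E -> dim Z = s%:E.
Proof.
move=> P0.
have up s' : 0 <= s' -> s < s' -> vanishing s' Z.
  move=> s'0 ss; pose theta := (s' - s) * c / 2.
  have th0 : 0 < theta by rewrite divr_gt0// mulr_gt0// subr_gt0.
  apply: (pressure_lt_vanishing s'0 th0 (t := theta)); last first.
    by rewrite P0 lte_fin.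
  move=> x /Zc[[K KP] _ _]; exists ((s' - s) * K) => n.
  have ss0 : 0 <= s' - s by lra.
  by have := ler_wpM2l ss0 (KP n) => ?; rewrite /theta; lra.
have s_ge0 : 0 <= s.
  rewrite leNgt; apply/negP => sneg.
  have := pressure_set0 (vanishing0 DC (up 0 (lexx 0) sneg)).
  by rewrite P0 lee_fin; lra.
apply/eqP; rewrite eq_le; apply/andP; split.
  apply: lee_EFin_above => s'; rewrite lte_fin => ss.
  by apply: (dim_le_vanishing DC); [lra|apply: up; lra].
rewrite leNgt; apply/negP => /(dim_lt_bounded DC)[s0 [s00 s0s bZ]].
pose theta := (s - s0) * c / 4.
have th0 : 0 < theta by rewrite divr_gt0// mulr_gt0// subr_gt0.
have := @pressure_le s0 (- 2 * theta) theta s00 th0 bZ.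
rewrite P0 lee_fin => h; suff : 0 <= - 2 * theta + theta by lra.
apply: h => x /Zc[[K KP] _ _]; exists ((s - s0) * K) => n.
have ss0 : 0 <= s - s0 by lra.
by have := ler_wpM2l ss0 (KP n) => ?; rewrite /theta; lra.
Qed.

(** An upper bound for the exponents makes the pressure Lipschitz in [s], so
    that it cannot jump over zero at the dimension. *)
Lemma bowen_equation_solvable (beta : R) : Z !=set0 ->
  (forall x, Z x -> exists K : R, forall n, S n x <= n%:R * beta + K) ->
  dim Z = s%:E -> limP = 0%E.
Proof.
move=> [x0 Zx0] Zb dimZ.
pose b := `|beta| + 1; have b0 : 0 < b by rewrite ltr_wpDl.
have {}Zb x : Z x -> exists K : R, forall n, S n x <= n%:R * b + K.
  move=> /Zb[K KP]; exists K => n; apply: (le_trans (KP n)).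
  rewrite lerD2r ler_wpM2l// (le_trans (ler_norm _))// lerDl//.
(* Moving the exponent by at most [t / (2 b)] changes the pressure by at most
   [t / 2]. *)
have slope x (t r : R) : Z x -> 0 <= r -> r * b <= t / 2 ->
    exists C : R, forall n, r * S n x <= n%:R * (t / 2) + C.
  move=> /Zb[K KP] r0 rb; exists (r * K) => n.
  have := ler_wpM2l r0 (KP n).
  have : n%:R * (r * b) <= n%:R * (t / 2) by rewrite ler_wpM2l.
  by move=> ? ?; lra.
have kb t : t / (2 * b) * b = t / 2.
  by rewrite invfM mulrA -mulrA mulVf ?gt_eqF// mulr1.
apply/eqP; rewrite eq_le; apply/andP; split.
  apply: lee_EFin_above => t; rewrite lte_fin => t0.
  have k0 : 0 < t / (2 * b) by rewrite divr_gt0// mulr_gt0.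
  have [|s0 [s00 s0k bZ]] := dim_lt_bounded DC (s := s + t / (2 * b)) (Z := Z).
    by rewrite dimZ lte_fin ltrDl.
  have th0 : 0 < t / 8 by rewrite divr_gt0.
  apply: (@le_trans _ _ (3 * t / 4 + t / 8)%:E); last by rewrite lee_fin; lra.
  apply: (pressure_le s00 th0 bZ) => x Zx.
  have -> : 3 * t / 4 - 2 * (t / 8) = t / 2 by lra.
  have [ss0|s0s] := leP s s0.
    apply: slope => //; first lra.
    by rewrite -kb ler_wpM2r ?(ltW b0)//; lra.
  have [[K KP] _ _] := Zc Zx; exists ((s - s0) * K) => n.
  have ss0 : 0 <= s - s0 by lra.
  have := ler_wpM2l ss0 (KP n).
  have : 0 <= (s - s0) * (n%:R * c) by rewrite !mulr_ge0// ltW.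
  have : 0 <= n%:R * (t / 2) by rewrite mulr_ge0//; lra.
  by move=> ? ? ?; lra.
rewrite leNgt; apply/negP => P0.
have [t t0 Pt] : exists2 t : R, 0 < t & (limP < (- t)%:E)%E.
  case: limP P0 => [r| |]// r0; last by exists 1; rewrite ?ltNyr.
  by exists (- r / 2); rewrite ?lte_fin; rewrite lte_fin in r0; lra.
have s_ge0 : 0 <= s.
  rewrite leNgt; apply/negP => sneg.
  have [|s0 [s00 s0neg _]] := dim_lt_bounded DC (s := 0) (Z := Z).
    by rewrite dimZ lte_fin.
  by rewrite ltNge s00 in s0neg.
have k0 : 0 < t / (2 * b) by rewrite divr_gt0// mulr_gt0.
have t2 : 0 < t / 2 by rewrite divr_gt0.
pose s' := Num.max (s - t / (2 * b)) 0.
have s'0 : 0 <= s' by rewrite le_max lexx orbT.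
have s's : s' <= s by rewrite ge_max s_ge0 andbT; lra.
have s'k : s - t / (2 * b) <= s' by rewrite le_max lexx.
have vZ : vanishing s' Z.
  apply: (pressure_lt_vanishing s'0 t2 _ Pt) => x Zx.
  have [||C CP] := slope x t (s - s') Zx; first lra.
    by rewrite -kb ler_wpM2r ?(ltW b0)//; lra.
  by exists C => n; have := CP n => ?; lra.
have := dim_le_vanishing DC s'0 vZ; rewrite dimZ lee_fin => ss'.
have s'E : s' = 0.
  have [/max_r//|/ltW/max_l s'E] := leP (s - t / (2 * b)) 0.
  by move: ss'; rewrite /s' s'E => ?; lra.
by rewrite s'E in vZ; rewrite (vanishing0 DC vZ) in Zx0.
Qed.

End Equation.
End Bowen.

Unset Implicit Arguments.

Theorem theorem5 (R : realType) (X : metricType R) (T : X -> X) (a : X -> R)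
    (Z : set X) :
  complete_space X -> separable_space X -> conformal T a ->
  let u := fun x : X => log2 (a x) in
  Z `<=` avg_between T u 0%E +oo%E `&` tempered_contraction T u
         `&` sublinear_growth T u ->
  [/\ dim_H Z = dim_BS T Z u,
      dim_P Z = Dim_BS T Z u &
      forall alpha : R, 0 < alpha ->
        (forall x, Z x -> (alpha%:E <= lower_avg T u x)%E) ->
        (* uniqueness: a solution of a Bowen equation is the dimension *)
        (forall s : R,
           (lower_pressure T Z (fun x => - s * u x) = 0%E -> dim_H Z = s%:E) /\
           (upper_pressure T Z (fun x => - s * u x) = 0%E -> dim_P Z = s%:E)) /\
        (* existence: the dimension, when finite, is a solution *)
        (Z !=set0 ->
         (exists beta : R, forall x, Z x -> (upper_avg T u x <= beta%:E)%E) ->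
         forall s : R,
           (dim_H Z = s%:E -> lower_pressure T Z (fun x => - s * u x) = 0%E) /\
           (dim_P Z = s%:E -> upper_pressure T Z (fun x => - s * u x) = 0%E))].
Proof.
move=> _ sep conf u ZABC.
have Du := conformal_distortion conf; rewrite -/u in Du.
have ZP x : Z x -> [/\ (0%:E < lower_avg T u x)%E,
    tempered_contraction T u x & sublinear_growth T u x].
  by move=> /ZABC[[[l0 _ _] tc] sg].
have HC := hausdorff_comparison T u; have PC := packing_comparison T u sep.
split.
- apply: (dim_eq_scale_limit HC Du) ZP => [e e'|e|e s|e s].
  + exact: dim_BS_at_mono.
  + exact: dim_BS_at_ge0.
  + exact: dim_BS_at_lt.
  + exact: dim_BS_at_le.
- apply: (dim_eq_scale_limit PC Du) ZP => [e e'|e|e s|e s].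
  + exact: Dim_BS_at_mono.
  + exact: Dim_BS_at_ge0.
  + exact: Dim_BS_at_lt.
  + exact: Dim_BS_at_le.
move=> alpha alpha0 Zalpha.
have c0 : 0 < alpha / 2 by rewrite divr_gt0.
have Zc : Z `<=` expanding T u (alpha / 2).
  move=> x Zx; have [_ tc sg] := ZP x Zx; split=> //.
  apply: lower_avg_gt; apply: lt_le_trans (Zalpha x Zx).
  by rewrite lte_fin ltr_pdivrMr// mulr_natr mulr2n ltrDl.
have lower_lt s e t := @lower_pressure_at_lt R X T Z (fun x => - s * u x) e t.
have lower_le s e t t' : t < t' ->
    bowen_null T e (pressure_weight T (fun x => - s * u x) t e) Z ->
    (lower_pressure_at T Z (fun x => - s * u x)%R e <= t'%:E)%E.
  move=> tt /lower_pressure_at_le/le_trans; apply.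
  by rewrite lee_fin ltW.
have upper_lt s e t : (upper_pressure_at T Z (fun x => - s * u x)%R e < t%:E)%E ->
    exists2 t0 : R, t0 <= t & sigma_cover (span_bounded T e
      (pressure_weight T (fun x => - s * u x) t0 e)) Z.
  by move=> /upper_pressure_at_lt tZ; exists t.
have upper_le s e t t' := @upper_pressure_at_le R X T Z (fun x => - s * u x) e t t'.
split=> [s|Z0 [beta Zbeta] s].
  split.
    exact: (bowen_equation_unique HC Du c0 Zc (lower_lt s) (lower_le s)).
  exact: (bowen_equation_unique PC Du c0 Zc (upper_lt s) (upper_le s)).
have Zb x : Z x -> exists K : R, forall n,
    birkhoff T u n x <= n%:R * (beta + 1) + K.
  move=> Zx; apply: upper_avg_lt; apply: (le_lt_trans (Zbeta x Zx)).
  by rewrite lte_fin ltrDl.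
split.
  exact: (bowen_equation_solvable HC Du c0 Zc (lower_lt s) (lower_le s) Z0 Zb).
exact: (bowen_equation_solvable PC Du c0 Zc (upper_lt s) (upper_le s) Z0 Zb).
Qed.
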